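(* Let $\mu>0$. For $x\in\mathcal{E}$, assume $\{\lambda_j(x)\}$ is the set of distinct eigenvalues of $x$, and let $m_j$ denote the multiplicity of $\lambda_j(x)$ (that is, the multiplicity of $\lambda_j(x)$ as a root of $\lambda\mapsto p(x-\lambda e)$). Then $$\nabla f_\mu(x)=\frac{1}{\sum_jm_j\exp(\lambda_j(x)/\mu)}\sum_j\frac{m_j\exp(\lambda_j(x)/\mu)}{p^{(m_j)}(x-\lambda_j(x)e)}\,\nabla p^{(m_j-1)}(x-\lambda_j(x)e),$$ a convex combination of the vectors $\frac{1}{p^{(m_j)}(x-\lambda_j(x)e)}\nabla p^{(m_j-1)}(x-\lambda_j(x)e)$ (vectors which are independent of $\mu$).
   Context: Let $\mathcal{E}$ be a finite-dimensional real Euclidean space, and $\mathcal{K}\subsetneq\mathcal{E}$ a closed convex cone with nonempty interior that is a hyperbolicity cone: there is a real homogeneous polynomial $p:\mathcal{E}\to\mathbb{R}$ (a hyperbolic polynomial for $\mathcal{K}$) such that (1) $\mathrm{int}(\mathcal{K})$ is a connected component of $\{x:p(x)\neq0\}$, and (2) for some (equivalently, every) $e\in\mathrm{int}(\mathcal{K})$ and all $x\in\mathcal{E}$, the univariate polynomial $\lambda\mapsto p(x-\lambda e)$ has only real roots. Fix such $p$, let $n=\deg p$, and fix $e\in\mathrm{int}(\mathcal{K})$. The eigenvalues of $x\in\mathcal{E}$ are the roots of $\lambda\mapsto p(x-\lambda e)$. For $\mu>0$, $f_\mu(x):=\mu\ln\sum\exp(\lambda/\mu)$, the sum being over the $n$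 eigenvalues $\lambda$ of $x$ counted with multiplicity; equivalently, $f_\mu(x)=\mu\ln\sum_jm_j\exp(\lambda_j(x)/\mu)$ over distinct eigenvalues. For $m=0,1,\dots,n$, $p^{(m)}(y):=\frac{d^m}{dt^m}p(y+te)\big|_{t=0}$. Gradients are with respect to the inner product on $\mathcal{E}$. *)

(* Defs.v *)
From HB Require Import structures.
From mathcomp Require Import all_boot all_order all_algebra.
From mathcomp Require Import all_classical all_reals all_analysis.
From mathcomp Require Import complex polyrcf.
(* The notations of mpoly are incompatible with those of MathComp-Analysis. *)
From mathcomp Require mpoly.
Import -(notations) mpoly.

Set Implicit Arguments.
Unset Strict Implicit.
Unset Printing Implicit Defensive.

Import Order.TTheory GRing.Theory Num.Theory.
Import numFieldNormedType.Exports.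

Local Open Scope classical_set_scope.
Local Open Scope ring_scope.

HB.mixin Record NormedModule_isEuclidean (R : realType) E
    of NormedModule R E & Vector R E := {
  inner : {dot E for (@idfun R)} ;
  inner_normE : forall x : E, inner x x = `|x| ^+ 2
}.

#[short(type="euclideanType")]
HB.structure Definition Euclidean (R : realType) :=
  {E of NormedModule_isEuclidean R E & NormedModule R E & Vector R E}.

Section Gradient.
Variables (R : realType) (E : euclideanType R).

Definition is_gradient (f : E -> R) (x g : E) : Prop :=
  differentiable f x /\ forall v : E, 'd f x v = inner g v.

(* 0 where [f] is not differentiable *)
Definition grad (f : E -> R) (x : E) : E :=
  xget 0 [set g | is_gradient f x g].

Lemma is_gradient_grad (f : E -> R) (x g : E) :
  is_gradient f x g -> grad f x = g.
Proof.
move=> H; have [_ h] : is_gradient f x (grad f x) by exact: (xgetI 0 H).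
case: H => _ h'.
apply/eqP; rewrite -subr_eq0 -normr_eq0 -sqrf_eq0 -inner_normE.
by rewrite linearBl /= -h -h' subrr.
Qed.

End Gradient.

Section Hyperbolic.
Variables (R : realType) (E : euclideanType R).
Implicit Types (p : E -> R) (K : set E) (e x : E) (n : nat).

Definition is_cone K : Prop := forall (t : R) x, 0 < t -> K x -> K (t *: x).

(* Polynomiality does not depend on the basis used to read off coordinates. *)
Definition homogeneous_poly n p : Prop :=
  exists2 q : mpoly (\dim {:E}) R,
    q \is ishomog1 n mdeg
    & forall x, p x = meval (fun i => coord (vbasis {:E}) i x) q.

(* The polynomial l |-> p (x - l e): since R is infinite there is exactly one
   with these values when p is polynomial. *)
Definition charpoly p e x : {poly R} :=
  xget 0 [set P : {poly R} | forall l : R, P.[l] = p (x - l *: e)].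

Lemma charpolyE n p e x (l : R) :
  homogeneous_poly n p -> (charpoly p e x).[l] = p (x - l *: e).
Proof.
case=> q _ pE.
pose c i := coord (vbasis {:E}) i.
pose P : {poly R} := mmap (@polyC R) (fun i => (c i x)%:P - (c i e) *: 'X) q.
have HP : [set P : {poly R} | forall l : R, P.[l] = p (x - l *: e)] P.
  move=> t; rewrite pE /P /meval /mmap horner_sum; apply: eq_bigr => m _.
  rewrite hornerM hornerC; congr (_ * _).
  rewrite /mmap1 horner_prod; apply: eq_bigr => i _.
  rewrite horner_exp !hornerE linearB /c /=; congr (_ ^+ _).
  by rewrite [coord _ _ (t *: e)]linearZ; congr (_ - _); apply: mulrC.
by have := xgetI 0 HP; exact.
Qed.

Definition only_real_roots (P : {poly R}) : Prop :=
  forall z : R[i], root (map_poly (real_complex R) P) z -> z \is Num.real.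

(* In the second condition a single direction is required; p need not be
   assumed nonzero, since {p != 0} has a component. *)
Definition hyperbolic_poly n p K : Prop :=
  [/\ homogeneous_poly n p,
      exists2 x, p x != 0
        & K° = connected_component [set y | p y != 0] x
    & exists2 e, K° e & forall x, only_real_roots (charpoly p e x)].

(* each root repeated according to its multiplicity *)
Definition eigenvalues p e x : seq R :=
  flatten [seq nseq (mup l (charpoly p e x)) l
          | l <- rootsR (charpoly p e x)].

Definition fmu p e (mu : R) x : R :=
  mu * ln (\sum_(l <- eigenvalues p e x) expR (l / mu)).

Definition dirder p e (m : nat) (y : E) : R :=
  derive1n m (fun t : R => p (y + t *: e)) 0.

End Hyperbolic.

Definition convex_combination (R : realType) (V : lmodType R) (I : eqType)
    (s : seq I) (c : I -> R) (v : I -> V) (y : V) : Prop :=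
  [/\ forall i, i \in s -> 0 <= c i,
      \sum_(i <- s) c i = 1
    & y = \sum_(i <- s) c i *: v i].

(* Main.v *)
Require Import Defs.
From HB Require Import structures.
From mathcomp Require Import all_boot all_order all_algebra.
From mathcomp Require Import all_classical all_reals all_analysis.
From mathcomp Require Import complex polyrcf ring lra.
From mathcomp Require mpoly.
Import -(notations) mpoly.

(* Hyperbolicity in one direction of the cone gives hyperbolicity in every
   direction e of its interior (Garding): the roots in t of p(i e' + t e + s x)
   never cross the real axis as s varies, and they have negative imaginary part
   for s = 0.

   By Newton's identities, y |-> sum of q(z) over the eigenvalues z of y is
   polynomial in y for every polynomial q.  For q = prod_j (X - l_j)^2, with l_j
   the eigenvalues of x, this sum is nonnegative because the eigenvalues are
   real, and it vanishes at x; hence it is O(|h|^2) at x + h, i.e. each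
   eigenvalue of x + h is within O(|h|) of some l_j.  Continuity of such sums
   also shows that exactly m_j eigenvalues of x + h are close to l_j.  Let b_j
   be the sum of the displacements z - l_j over this cluster.  Expanding the
   characteristic polynomial of x + h to first order in the displacements and
   comparing the coefficients of (X - l_j)^(m_j - 1) gives
     b_j = m_j / p^(m_j) (x - l_j e)
             * <grad p^(m_j - 1) (x - l_j e), h> + O(|h|^2),
   and sum exp(z / mu) varies by sum_j exp(l_j / mu) / mu * b_j + O(|h|^2). *)

Set Implicit Arguments.
Unset Strict Implicit.
Unset Printing Implicit Defensive.

Import Order.TTheory GRing.Theory Num.Theory.
Import numFieldNormedType.Exports Normc.

Local Open Scope classical_set_scope.
Local Open Scope ring_scope.

(** * Restriction of a homogeneous polynomial to a line *)

Section LinePoly.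

(** [a] and [b] are only degree bounds, and the coefficients there may vanish, so this holds over
    any commutative ring. In the convolution, an index below [a] leaves to [B] a rank beyond [b],
    and an index above [a] falls outside [A]. *)
Lemma size_coef_mul (R : comNzRingType) (A B : {poly R}) (a b : nat) :
  (size A <= a.+1)%N -> (size B <= b.+1)%N ->
  (size (A * B)%R <= (a + b).+1)%N /\ (A * B)`_(a + b) = A`_a * B`_b.
Proof.
move=> sA sB; split.
  apply: leq_trans (size_polyMleq _ _) _.
  by rewrite -subn1 leq_subLR add1n -addSn -addnS leq_add.
have lea : (a < (a + b).+1)%N by rewrite ltnS leq_addr.
rewrite coefM (bigD1 (Ordinal lea)) //= addKn big1 ?addr0 // => i /eqP ne.
have [lt|ge] := ltnP i a.
  rewrite [B`__]nth_default ?mulr0 //; apply: leq_trans sB _.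
  by rewrite -addnBAC ?(ltnW lt) // -[b.+1]add1n leq_add2r subn_gt0.
rewrite nth_default ?mul0r //; apply: leq_trans sA _.
by rewrite ltn_neqAle ge andbT; apply/eqP => E; apply: ne; apply/val_inj.
Qed.

Lemma size_coef_exp (R : comNzRingType) (u v : R) (k : nat) :
  (size ((u%:P + v *: 'X) ^+ k)%R <= k.+1)%N /\ ((u%:P + v *: 'X) ^+ k)`_k = v ^+ k.
Proof.
elim: k => [|k [IHs IHc]]; first by rewrite expr0 size_poly1 coef1.
have s1 : (size (u%:P + v *: 'X : {poly R})%R <= 2)%N.
  apply: leq_trans (size_polyD _ _) _; rewrite geq_max.
  rewrite (leq_trans (size_polyC_leq1 _)) //=.
  by apply: leq_trans (size_scale_leq _ _) _; rewrite size_polyX.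
have [sz cf] := size_coef_mul s1 IHs.
by rewrite exprS; split=> //; rewrite cf IHc coefD coefC coefZ coefX mulr1 add0r exprS.
Qed.

Variables (R S : comNzRingType) (f : {rmorphism R -> S}) (d : nat).
Variable (q : mpoly d R).

(** The target ring [S] varies: the reals for [charpoly], the complex numbers for Garding's
    argument, and polynomials over the complex numbers when a parameter of the line is made
    formal. *)
Definition line_poly (u v : 'I_d -> S) : {poly S} :=
  mmap (@polyC S \o f) (fun i => (u i)%:P + v i *: 'X) q.

Lemma horner_line_poly u v t :
  (line_poly u v).[t] = mmap f (fun i => u i + t * v i) q.
Proof.
rewrite /line_poly /mmap horner_sum; apply: eq_bigr => m _ /=.
rewrite hornerM hornerC; congr (_ * _).
rewrite /mmap1 horner_prod; apply: eq_bigr => i _.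
by rewrite horner_exp !hornerE [t * _]mulrC.
Qed.

(** Each monomial of [q] has total degree [n], so rank [n] is reached only by taking the [v] part of
    every linear factor. *)
Lemma size_coef_line_poly n u v : q \is ishomog1 n mdeg ->
  (size (line_poly u v) <= n.+1)%N /\ (line_poly u v)`_n = mmap f v q.
Proof.
move=> /allP qh; rewrite /line_poly /mmap.
have mon m : m \in msupp q ->
  (size ((@polyC S \o f) (mcoeff m q) * mmap1 (fun i => (u i)%:P + v i *: 'X) m)%R
     <= n.+1)%N /\
  ((@polyC S \o f) (mcoeff m q) * mmap1 (fun i => (u i)%:P + v i *: 'X) m)`_n
     = f (mcoeff m q) * mmap1 v m.
  move=> /qh /= /eqP <-; rewrite mdegE /mmap1 /= coefCM.
  have [sz ->] : (size (\prod_(i < d) ((u i)%:P + v i *: 'X) ^+ m i)%R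
                 <= (\sum_i m i).+1)%N /\
    (\prod_(i < d) ((u i)%:P + v i *: 'X) ^+ m i)`_(\sum_i m i)
       = \prod_(i < d) v i ^+ m i.
    elim/big_ind3: _ => [|A a1 a2 B b1 b2 [sA cA] [sB cB]|i _].
    - by rewrite size_poly1 coef1.
    - by have [sAB ->] := size_coef_mul sA sB; rewrite cA cB.
    - exact: size_coef_exp.
  split=> //; rewrite mul_polyC.
  exact: leq_trans (size_scale_leq _ _) sz.
split.
  apply: leq_trans (size_sum _ _ _) _.
  by apply/bigmax_leqP_seq => m mq _; have [] := mon m mq.
rewrite coef_sum; apply: eq_big_seq => m mq; by have [] := mon m mq.
Qed.

Lemma mmap_homog n (v : 'I_d -> S) t : q \is ishomog1 n mdeg ->
  mmap f (fun i => t * v i) q = t ^+ n * mmap f v q.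
Proof.
move=> /allP qh; rewrite /mmap mulr_sumr; apply: eq_big_seq => m /qh /= /eqP <-.
rewrite mulrCA; congr (_ * _); rewrite mdegE /mmap1.
elim/big_rec3: _ => [|i a b c _ ->]; first by rewrite expr0 mul1r.
by rewrite exprMn exprD; ring.
Qed.

End LinePoly.

(** * Newton identities and polynomial estimates *)

Section Newton.
Variable R : comNzRingType.
Implicit Types s : seq R.

Definition psum s (k : nat) : R := \sum_(z <- s) z ^+ k.

(** Its coefficient of rank [k] is [(-1) ^+ k] times the [k]-th elementary symmetric function of
    [s]. *)
Definition rev_charpoly s : {poly R} := \prod_(z <- s) (1 - z *: 'X).

Lemma coef_1subZX (z : R) (p : {poly R}) k :
  ((1 - z *: 'X) * p)`_k = p`_k - z * (if k is j.+1 then p`_j else 0).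
Proof. by rewrite mulrBl mul1r coefB -scalerAl coefZ coefXM; case: k. Qed.

Lemma coef_XsubCM (z : R) (p : {poly R}) k :
  (('X - z%:P) * p)`_k = (if k is j.+1 then p`_j else 0) - z * p`_k.
Proof. by rewrite mulrBl coefB mul_polyC coefZ coefXM; case: k. Qed.

(** In generating functions: [rev_charpoly s] times the series of power sums equals [size s] times
    [rev_charpoly s] minus ['X] times its derivative. The series is truncated after rank [r]; a new
    root [z] adds a geometric series to it, which [1 - z *: 'X] inverts up to that rank. *)
Lemma newton_identity s r :
  \sum_(j < r.+1) (rev_charpoly s)`_j * psum s (r - j)
    = ((size s)%:R - r%:R) * (rev_charpoly s)`_r.
Proof.
pose T s : {poly R} := \poly_(k < r.+1) psum s k.
suff H k : (k <= r)%N ->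
    (rev_charpoly s * T s)`_k = ((size s)%:R - k%:R) * (rev_charpoly s)`_k.
  rewrite -H // coefM; apply: eq_bigr => j _; congr (_ * _).
  by rewrite coef_poly ltnS leq_subr.
elim: s k => [|z s IH] k kr.
  rewrite /rev_charpoly big_nil mul1r coef_poly ltnS kr /psum big_nil coef1 /=.
  by case: eqP => [->|_]; rewrite ?subrr ?mul0r ?mulr0.
have -> : T (z :: s) = T s + \poly_(k < r.+1) z ^+ k.
  apply/polyP => j; rewrite coefD !coef_poly; case: ifP => _; last by rewrite addr0.
  by rewrite /psum big_cons addrC.
have geo j : (j <= r)%N -> ((1 - z *: 'X) * \poly_(k < r.+1) z ^+ k)`_j = (j == 0%N)%:R.
  move=> jr; rewrite coef_1subZX coef_poly ltnS jr.
  case: j jr => [|j] jr; first by rewrite mulr0 subr0 expr0.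
  by rewrite coef_poly ltnS (ltnW jr) -exprS subrr.
rewrite /rev_charpoly big_cons -/(rev_charpoly s) mulrDr coefD -!mulrA coef_1subZX.
have -> : ((1 - z *: 'X) * (rev_charpoly s * \poly_(k < r.+1) z ^+ k))`_k
          = (rev_charpoly s)`_k.
  rewrite mulrCA coefM (bigD1 ord_max) //= subnn geo // mulr1 big1 ?addr0 //.
  move=> j nj; rewrite geo ?(leq_trans (leq_subr _ _) kr) //.
  rewrite subn_eq0 leqNgt.
  have -> : (j < k)%N.
    rewrite ltn_neqAle -ltnS ltn_ord andbT.
    by apply: contraNN nj => /eqP E; apply/eqP/val_inj.
  by rewrite mulr0.
rewrite IH // coef_1subZX.
case: k kr => [|k] kr; first by rewrite /= -natr1; ring.
by rewrite IH ?(ltnW kr) //= -!natr1; ring.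
Qed.

Lemma size_rev_charpoly s : (size (rev_charpoly s) <= (size s).+1)%N.
Proof.
elim: s => [|z s IH]; first by rewrite /rev_charpoly big_nil size_poly1.
rewrite /rev_charpoly big_cons -/(rev_charpoly s).
apply/leq_sizeP => j; rewrite /= => sj.
rewrite coef_1subZX; case: j sj => // j sj.
by rewrite !nth_default ?mulr0 ?subr0 //; apply: leq_trans IH _ => //; apply: ltnW.
Qed.

Lemma coef_rev_charpoly s k : (k <= size s)%N ->
  (rev_charpoly s)`_k = (\prod_(z <- s) ('X - z%:P))`_(size s - k).
Proof.
elim: s k => [|z s IH] k ks.
  by rewrite /rev_charpoly !big_nil; move: ks; rewrite leqn0 => /eqP ->.
rewrite /rev_charpoly !big_cons -/(rev_charpoly s) coef_1subZX coef_XsubCM.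
case: k ks => [|k] ks; last first.
  rewrite /= subSS -(IH k) //; congr (_ - _).
  have [lt|ge] := ltnP k (size s).
    by rewrite -(subnSK lt) IH.
  have -> : k = size s by apply/eqP; rewrite eqn_leq ge andbT; exact: ks.
  by rewrite subnn nth_default // (leq_trans (size_rev_charpoly _)).
rewrite mulr0 subr0 IH // subn0 /= [X in _ - z * X]nth_default ?mulr0 ?subr0 //.
by rewrite size_prod_XsubC.
Qed.

End Newton.

Lemma horner_lipschitz (R : numDomainType) (q : {poly R}) (l : R) :
  exists2 C : R, 0 <= C & forall a, `|a| <= 1 -> `|q.[l + a] - q.[l]| <= C * `|a|.
Proof.
elim/poly_ind: q => [|q c [C C0 IH]].
  by exists 0 => // a _; rewrite !horner0 subrr normr0 mul0r.
exists (C * (`|l| + 1) + `|q.[l]|).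
  by rewrite addr_ge0 // mulr_ge0 // addr_ge0.
move=> a a1; rewrite !hornerE.
have -> : q.[l + a] * (l + a) + c - (q.[l] * l + c)
   = (q.[l + a] - q.[l]) * (l + a) + q.[l] * a by ring.
apply: le_trans (ler_normD _ _) _; rewrite !normrM mulrDl lerD //.
rewrite mulrAC ler_pM ?IH //.
by apply: le_trans (ler_normD _ _) _; rewrite lerD2l.
Qed.

Section Expansion.
Variable R : realFieldType.
Implicit Types (s : seq R) (sg : R -> R).

(* prod (X - sg z) - prod (X - z), up to second order in the z - sg z *)
Definition lin_term sg s : {poly R} :=
  \sum_(z <- s) (z - sg z) *: (\prod_(w <- s) ('X - (sg w)%:P) %/ ('X - (sg z)%:P)).

Lemma lin_term_cons sg z s :
  lin_term sg (z :: s) = (z - sg z) *: \prod_(w <- s) ('X - (sg w)%:P)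
    + ('X - (sg z)%:P) * lin_term sg s.
Proof.
rewrite /lin_term !big_cons mulKp ?polyXsubC_eq0 //; congr (_ + _).
rewrite mulr_sumr; apply: eq_big_seq => w ws; rewrite -scalerAr; congr (_ *: _).
rewrite divp_mulA //; apply: (dvdp_trans _ (dvdpp _)).
by rewrite (big_rem w) //= dvdp_mulIl.
Qed.

(** The constant depends on [n] and [M] only, hence serves at once for the eigenvalues of all the
    points [x + h]. *)
Lemma prod_XsubC_expansion (M : R) n : 0 <= M ->
  exists2 A : R, 0 <= A & forall sg s (eps : R), size s = n -> 0 <= eps <= 1 ->
    (forall z, z \in s -> `|sg z| <= M /\ `|z - sg z| <= eps) ->
  forall k, `|(\prod_(z <- s) ('X - z%:P) - \prod_(z <- s) ('X - (sg z)%:P)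
              + lin_term sg s)`_k| <= A * eps ^+ 2.
Proof.
move=> M0.
(* The recursions mix the product, the linear term and the remainder of the shorter list, so the
   three bounds go through the induction together. *)
suff: exists2 A : R, 0 <= A & forall sg s (eps : R), size s = n -> 0 <= eps <= 1 ->
    (forall z, z \in s -> `|sg z| <= M /\ `|z - sg z| <= eps) ->
  forall k, [/\ `|(\prod_(z <- s) ('X - (sg z)%:P))`_k| <= A,
    `|(lin_term sg s)`_k| <= A * eps &
    `|(\prod_(z <- s) ('X - z%:P) - \prod_(z <- s) ('X - (sg z)%:P)
              + lin_term sg s)`_k| <= A * eps ^+ 2].
  by case=> A A0 H; exists A => // sg s eps sn e01 sM k; have [] := H sg s eps sn e01 sM k.
elim: n => [|n [A A0 IH]].
  exists 1 => // sg s eps /size0nil -> /andP[e0 e1] _ k.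
  rewrite /lin_term !big_nil subrr addr0 coef0 normr0 coef1.
  split; rewrite ?mul1r ?sqr_ge0 //.
  by case: eqP => _; rewrite ?normr1 ?normr0.
(* [1 + M] pays for a multiplication by ['X - (sg z)%:P], and [2] for the two terms with the factor
   [z - sg z] in the remainder. *)
exists (A * (3 + M)); first by rewrite mulr_ge0 // addr_ge0.
move=> sg [//|z s] eps [] sn /andP[e0 e1] sM.
have /(IH _ _ _ sn) H : 0 <= eps <= 1 by rewrite e0.
have {}H := H sg (fun w ws => sM w (mem_behead (s := z :: s) ws)).
have [szM sze] := sM z (mem_head _ _).
rewrite lin_term_cons !big_cons.
move: H; set Q := \prod_(w <- s) ('X - (sg w)%:P); set P := \prod_(w <- s) ('X - w%:P).
set T := lin_term sg s; set E := P - Q + T => H.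
have -> : ('X - z%:P) * P - ('X - (sg z)%:P) * Q + ((z - sg z) *: Q + ('X - (sg z)%:P) * T)
  = ('X - (sg z)%:P) * E + (z - sg z) *: T - (z - sg z) *: E.
  have -> : P = E + Q - T by rewrite /E; ring.
  by rewrite -!mul_polyC polyCB; ring.
have shift (p : {poly R}) (B : R) : 0 <= B -> (forall k, `|p`_k| <= B) ->
    forall k, `|(('X - (sg z)%:P) * p)`_k| <= B * (1 + M).
  move=> B0 pB k; rewrite coef_XsubCM; apply: le_trans (ler_normB _ _) _.
  rewrite mulrDr mulr1 lerD //; first by case: k => [|k]; rewrite ?normr0.
  by rewrite normrM mulrC ler_pM.
have esq : eps ^+ 2 <= eps by rewrite expr2 ler_piMr.
have e20 : 0 <= eps ^+ 2 by rewrite sqr_ge0.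
move=> k; split.
- apply: le_trans (shift Q A A0 (fun k => let: And3 a _ _ := H k in a) k) _.
  by rewrite ler_wpM2l //; lra.
- rewrite coefD coefZ; apply: le_trans (ler_normD _ _) _.
  have h1 := shift T (A * eps) (mulr_ge0 A0 e0) (fun k => let: And3 _ a _ := H k in a) k.
  have [h2 _ _] := H k.
  have h3 : `|(z - sg z) * Q`_k| <= eps * A by rewrite normrM ler_pM.
  nra.
rewrite coefB coefD !coefZ; apply: le_trans (ler_normB _ _) _.
have := ler_normD (('X - (sg z)%:P) * E)`_k ((z - sg z) * T`_k).
have h1 := shift E (A * eps ^+ 2) (mulr_ge0 A0 e20) (fun k => let: And3 _ _ a := H k in a) k.
have [_ h2 h3] := H k.
have h4 : `|(z - sg z) * T`_k| <= eps * (A * eps) by rewrite normrM ler_pM.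
have h5 : `|(z - sg z) * E`_k| <= 1 * (A * eps ^+ 2).
  by rewrite normrM ler_pM // (le_trans sze).
rewrite expr2 in h1 h5 *; lra.
Qed.

(** If [z] is within [eta] of [l], the other factors are at least [eta] and the product controls the
    distance to [l]. Otherwise the product over the other points, which controls the distance to one
    of them, is at most the full product divided by [eta]. *)
Lemma dist_seq_le_prod (lam : seq R) : uniq lam -> lam != [::] ->
  exists2 C : R, 0 <= C & forall z, exists2 l, l \in lam &
    `|z - l| <= C * `|\prod_(w <- lam) (z - w)|.
Proof.
elim: lam => // l [|l' lam] IH /andP[nl ul] _.
  by exists 1 => // z; exists l; rewrite ?mem_head // big_seq1 mul1r.
have [C C0 H] := IH ul isT.
have [eta eta0 far] : exists2 eta : R, 0 < eta &
    forall w, w \in l' :: lam -> eta <= `|l - w| / 2.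
  elim: (l' :: lam) nl => [|a t IHt]; first by exists 1.
  rewrite inE negb_or => /andP[la /IHt [eta eta0 far]].
  exists (Num.min eta (`|l - a| / 2)).
    by rewrite lt_min eta0 divr_gt0 // normr_gt0 subr_eq0.
  move=> w; rewrite inE => /orP[/eqP ->|/far h]; first by rewrite ge_min lexx orbT.
  by rewrite ge_min h.
set t := l' :: lam in nl ul H far *.
have ne0 : 0 < eta ^- size t by rewrite invr_gt0 exprn_gt0.
exists (C / eta + eta ^- size t).
  by rewrite addr_ge0 // ?divr_ge0 // ltW.
move=> z; rewrite big_cons normrM.
have [near|farz] := ltP `|z - l| eta.
  exists l; rewrite ?mem_head //.
  have h : eta ^+ size t <= `|\prod_(w <- t) (z - w)|.
    have {}far w : w \in t -> eta <= `|z - w|.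
      move=> /far; have := ler_distD z l w; rewrite [`|l - z|]distrC.
      by move: near; lra.
    elim: t far {nl ul H ne0} => [|w t' IHt] far; first by rewrite big_nil normr1.
    rewrite big_cons normrM exprS ler_pM ?exprn_ge0 ?(ltW eta0) //.
      by apply: far; rewrite mem_head.
    by apply: IHt => v vt; apply: far; rewrite inE vt orbT.
  have h1 : 1 <= eta ^- size t * `|\prod_(w <- t) (z - w)|.
    by rewrite mulrC ler_pdivlMr ?exprn_gt0 // mul1r.
  rewrite mulrDl; apply: ler_wpDl.
    by rewrite !mulr_ge0 ?invr_ge0 // ltW.
  by rewrite mulrCA -[leLHS]mulr1 ler_wpM2l.
have [m mt hm] := H z; exists m; first by rewrite inE mt orbT.
apply: le_trans hm _; rewrite mulrDl; apply: ler_wpDr.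
  by rewrite !mulr_ge0 // ltW.
rewrite -mulrA ler_wpM2l // mulrA -[leLHS]mul1r ler_wpM2r //.
by rewrite mulrC ler_pdivlMr // mul1r.
Qed.

Lemma coef_comp_bound (l : R) (n k : nat) :
  exists2 C : R, 0 <= C & forall (p : {poly R}) (B : R), (size p <= n)%N ->
    (forall i, `|p`_i| <= B) -> `|(p \Po ('X + l%:P))`_k| <= C * B.
Proof.
exists (\sum_(i < n) `|(('X + l%:P) ^+ i)`_k|); first exact: sumr_ge0.
move=> p B sp pB; rewrite comp_polyE.
rewrite (big_ord_widen n (fun i => p`_i *: ('X + l%:P) ^+ i)) // big_mkcond /=.
rewrite coef_sum; apply: le_trans (ler_norm_sum _ _ _) _.
rewrite mulr_suml; apply: ler_sum => i _.
case: ifP => _.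
  by rewrite coefZ normrM mulrC ler_wpM2l.
by rewrite coef0 normr0 mulr_ge0 // (le_trans _ (pB 0%N)).
Qed.

End Expansion.

(** * Real-rooted polynomials and multiplicities *)

Section Roots.
Variable R : rcfType.
Implicit Types (s lam : seq R) (P : {poly R}).

Lemma split_real_roots P : P != 0 ->
  (forall z : R[i], root (map_poly (real_complex R) P) z -> z \is Num.real) ->
  exists s, P = lead_coef P *: \prod_(z <- s) ('X - z%:P).
Proof.
move=> P0 rr; have [r Pr] := closed_field_poly_normal (map_poly (real_complex R) P).
have cz : lead_coef (map_poly (real_complex R) P) != 0.
  by rewrite lead_coef_eq0 map_poly_eq0.
have r_real (z : R[i]) : z \in r -> (complex.Re z)%:C%C = z.
  move=> zr; apply: RRe_real; apply: rr; rewrite Pr rootZ // root_prod_XsubC //.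
exists (map (@complex.Re R) r); apply: (map_inj_poly (@complexI R)); first by rewrite rmorph0.
rewrite Pr lead_coef_map linearZ /= rmorph_prod big_map; congr (_ *: _).
apply: eq_big_seq => z zr; rewrite rmorphB /= map_polyX map_polyC /=.
by rewrite r_real.
Qed.

Lemma mup_prod_XsubC (c l : R) s : c != 0 ->
  mup l (c *: \prod_(z <- s) ('X - z%:P)) = count_mem l s.
Proof.
move=> c0; rewrite -mul_polyC mupMr ?rootC //.
elim: s => [|z s IH]; first by rewrite big_nil mupNroot // root1.
rewrite big_cons mupM ?polyXsubC_eq0 ?monic_neq0 ?monic_prod_XsubC // IH /=.
by rewrite -[X in mup l X]expr1 mup_XsubCX; case: eqP.
Qed.

(** Both lists contain each root as often as its multiplicity. [lam] is an arbitrary enumeration of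
    the roots, so the one computed by [rootsR] can be exchanged for any other. *)
Lemma perm_roots P (c : R) s lam : c != 0 ->
  P = c *: \prod_(z <- s) ('X - z%:P) -> uniq lam ->
  (forall l, (l \in lam) = root P l) ->
  perm_eq s (flatten [seq nseq (mup l P) l | l <- lam]).
Proof.
move=> c0 PE ul lamP; apply/allP => l _ /=; apply/eqP.
have -> : count_mem l s = mup l P by rewrite PE mup_prod_XsubC.
have -> : mup l P = if l \in lam then mup l P else 0%N.
  by rewrite lamP; case: ifP => // /negbT /mupNroot.
elim: lam ul {lamP} => //= a t IH /andP[na ut]; rewrite count_cat -IH //.
rewrite count_nseq /= inE [l == a]eq_sym.
by case: eqP => [<-|_] /=; rewrite ?mul0n // mul1n (negbTE na) addn0.
Qed.

Lemma big_mult_roots (F : R -> R) P lam :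
  \sum_(z <- flatten [seq nseq (mup l P) l | l <- lam]) F z
    = \sum_(l <- lam) (mup l P)%:R * F l.
Proof.
rewrite big_flatten big_map; apply: eq_bigr => l _.
by rewrite big_nseq iter_addr_0 mulr_natl.
Qed.

Lemma shift_XsubC_exp (l : R) k P :
  (('X - l%:P) ^+ k * P) \Po ('X + l%:P) = 'X^k * (P \Po ('X + l%:P)).
Proof.
rewrite comp_polyM rmorphXn /= comp_polyB comp_polyX comp_polyC.
by rewrite addrK.
Qed.

(** Recentred at [l], [Q] has order exactly [m]. Removing a factor with [w != l] leaves the order at
    least [m], so rank [m.-1] only sees the removal of a factor at [l]. *)
Lemma shift_prod_XsubC (l : R) s :
  let m := count_mem l s in let Q := \prod_(z <- s) ('X - z%:P) in
  l \in s ->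
  (Q \Po ('X + l%:P))`_m != 0 /\ forall w, w \in s ->
  ((Q %/ ('X - w%:P)) \Po ('X + l%:P))`_m.-1
    = if w == l then (Q \Po ('X + l%:P))`_m else 0.
Proof.
move=> m Q ls.
pose U := \prod_(z <- [seq z <- s | z != l]) ('X - z%:P).
have QE : Q = ('X - l%:P) ^+ m * U.
  rewrite /Q (bigID (pred1 l)) /= -[X in X * _]big_filter -[X in _ * X]big_filter.
  congr (_ * _).
  rewrite (eq_big_seq (fun=> 'X - l%:P)); last first.
    by move=> z; rewrite mem_filter => /andP[/= /eqP ->].
  by rewrite big_const_seq count_predT size_filter iter_mulr_1.
have m0 : (0 < m)%N by rewrite -has_count has_pred1.
have Qm : (Q \Po ('X + l%:P))`_m = U.[l].
  by rewrite QE shift_XsubC_exp coefXnM ltnn subnn -horner_coef0 horner_comp !hornerE.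
split.
  rewrite Qm -[_ != 0]/(~~ root U l) root_prod_XsubC mem_filter eqxx //.
move=> w ws; rewrite Qm; case: eqP => [->|/eqP wl].
  rewrite QE -(prednK m0) exprS -mulrA mulKp ?polyXsubC_eq0 //=.
  by rewrite shift_XsubC_exp coefXnM ltnn subnn -horner_coef0 horner_comp !hornerE.
have wU : w \in [seq z <- s | z != l] by rewrite mem_filter wl.
rewrite QE /U (big_rem w) //= mulrCA mulKp ?polyXsubC_eq0 //.
by rewrite shift_XsubC_exp coefXnM prednK ?leqnn.
Qed.

End Roots.

(** * Hyperbolicity in every direction of the cone *)

(** Connectedness of the real line, with the openness of [P] and of its complement in metric
    form. *)
Lemma clopen_real (R : realType) (P : R -> Prop) (s0 : R) : P s0 ->
  (forall s, P s -> exists2 d : R, 0 < d & forall t, `|t - s| < d -> P t) ->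
  (forall s, ~ P s -> exists2 d : R, 0 < d & forall t, `|t - s| < d -> ~ P t) ->
  forall s, P s.
Proof.
move=> P0 oP cP.
have cR : connected [set: R] by apply/connected_intervalP.
have op (Q : R -> Prop) : (forall s, Q s -> exists2 d : R, 0 < d &
    forall t, `|t - s| < d -> Q t) -> open [set s | Q s].
  move=> H; rewrite openE => s /H [d d0 Hd]; apply/nbhs_ballP.
  by exists d => // t; rewrite -ball_normE /= distrC => /Hd.
suff E : [set s | P s] = [set: R].
  by move=> s; have : [set: R] s by []; rewrite -E.
apply: cR; first by exists s0.
- by exists [set s | P s]; [exact: op|rewrite setTI].
- exists [set s | P s]; last by rewrite setTI.
  by rewrite -openC; exact: op.
Qed.

(** * Complex polynomials with all roots in the open lower half-plane *)

Section ComplexRoots.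
Variable R : realType.
Local Notation C := R[i].
Local Notation N := (@normc R).
Local Notation Re := complex.Re.
Local Notation Im := complex.Im.

Lemma normc_ge0 (z : C) : 0 <= N z.
Proof. by case: z => a b; rewrite sqrtr_ge0. Qed.

Lemma normcD (x y : C) : N (x + y) <= N x + N y.
Proof. exact: le_normcD. Qed.

Lemma normcX (z : C) k : N (z ^+ k) = N z ^+ k.
Proof. by elim: k => [|k IH]; rewrite ?normc1 // !exprS normcM IH. Qed.

Lemma normc_prod (I : Type) (r : seq I) (F : I -> C) :
  N (\prod_(i <- r) F i) = \prod_(i <- r) N (F i).
Proof. by apply: big_morph; [exact: normcM|exact: normc1]. Qed.

Lemma normc_sum (I : Type) (r : seq I) (F : I -> C) :
  N (\sum_(i <- r) F i) <= \sum_(i <- r) N (F i).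
Proof.
elim: r => [|i r IH]; first by rewrite !big_nil normc0.
by rewrite !big_cons; apply: le_trans (normcD _ _) _; rewrite lerD2l.
Qed.

Lemma normc_real (u : R) : N u%:C%C = `|u|.
Proof. by rewrite /= expr0n addr0 sqrtr_sqr. Qed.

Lemma normc_ge_Im (z : C) : `|Im z| <= N z.
Proof.
by case: z => a b /=; rewrite -sqrtr_sqr ler_wsqrtr // lerDr sqr_ge0.
Qed.

(** Going up from a real point moves away from a root lying below the real axis. *)
Lemma normc_lower_root (r : C) (u v : R) : 0 <= v -> Im r < 0 ->
  N (u%:C%C - r) <= N ((u +i* v)%C - r) /\ v <= N ((u +i* v)%C - r).
Proof.
case: r => a b /= v0 b0; split.
  by rewrite ler_wsqrtr // lerD2l; nra.
rewrite -{1}(ger0_norm v0) -sqrtr_sqr ler_wsqrtr //.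
by have := sqr_ge0 (u - a); nra.
Qed.

Lemma horner_normc_bound (p : {poly C}) n (B : R) z : (size p <= n.+1)%N ->
  0 <= B -> (forall k, N p`_k <= B) -> N p.[z] <= B * n.+1%:R * (1 + N z) ^+ n.
Proof.
move=> sp B0 pB; rewrite (horner_coef_wide _ sp).
apply: le_trans (normc_sum _ _) _.
rewrite mulrAC -[n.+1 in leRHS]card_ord mulr_natr -sumr_const.
apply: ler_sum => i _; rewrite normcM normcX ler_pM ?exprn_ge0 ?normc_ge0 //.
have h : 1 <= 1 + N z by rewrite lerDl normc_ge0.
apply: (@le_trans _ _ ((1 + N z) ^+ i)); last first.
  by rewrite ler_weXn2l // -ltnS.
by rewrite lerXn2r ?nnegrE ?addr_ge0 ?normc_ge0 // lerDr.
Qed.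

Definition lower_roots (p : {poly C}) := forall z, root p z -> Im z < 0.

Lemma lower_roots_prod (p : {poly C}) : p != 0 -> lower_roots p ->
  exists2 r : seq C, p = lead_coef p *: \prod_(z <- r) ('X - z%:P) &
    forall z, z \in r -> Im z < 0.
Proof.
move=> p0 pl; have [r pr] := closed_field_poly_normal p; exists r => // z zr.
by apply: pl; rewrite pr rootZ ?lead_coef_eq0 // root_prod_XsubC.
Qed.

Lemma lower_roots_normc (p : {poly C}) (u v : R) : p != 0 -> lower_roots p ->
  0 <= v -> N p.[u%:C%C] <= N p.[(u +i* v)%C] /\
    N (lead_coef p) * v ^+ (size p).-1 <= N p.[(u +i* v)%C].
Proof.
move=> p0 /(lower_roots_prod p0)[r pr rl] v0.
have sr : (size p).-1 = size r.
  by rewrite pr size_scale ?lead_coef_eq0 // size_prod_XsubC.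
have E z : N p.[z] = N (lead_coef p) * \prod_(w <- r) N (z - w).
  rewrite pr hornerZ normcM lead_coefZ lead_coef_prod_XsubC mulr1; congr (_ * _).
  rewrite horner_prod normc_prod; apply: eq_bigr => w _.
  by rewrite !hornerE.
rewrite sr !E; split; rewrite ler_wpM2l ?normc_ge0 //.
  rewrite big_seq [leRHS]big_seq; apply: ler_prod => w /rl wl.
  by rewrite normc_ge0; have [] := normc_lower_root u v0 wl.
elim: r rl {pr sr E} => [|w r IH] rl; first by rewrite big_nil.
rewrite big_cons exprS ler_pM ?exprn_ge0 //.
  by have [] := normc_lower_root u v0 (rl w (mem_head _ _)).
by apply: IH => z zr; apply: rl; rewrite inE zr orbT.
Qed.

(** Growth of full degree on the closed upper half-plane, rather than mere nonvanishing, withstands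
    a small change of all the coefficients at every [z] at once. It is obtained factor by factor. *)
Lemma lower_roots_bound (p : {poly C}) : p != 0 -> lower_roots p ->
  exists2 k : R, 0 < k &
    forall z, 0 <= Im z -> k * (1 + N z) ^+ (size p).-1 <= N p.[z].
Proof.
move=> p0 /(lower_roots_prod p0)[r pr rl].
have sr : (size p).-1 = size r.
  by rewrite pr size_scale ?lead_coef_eq0 // size_prod_XsubC.
have E z : N p.[z] = N (lead_coef p) * \prod_(w <- r) N (z - w).
  rewrite pr hornerZ normcM lead_coefZ lead_coef_prod_XsubC mulr1; congr (_ * _).
  rewrite horner_prod normc_prod; apply: eq_bigr => w _.
  by rewrite !hornerE.
have lc : 0 < N (lead_coef p).
  rewrite lt_def normc_ge0 andbT; apply: contra_neq p0 => /eq0_normc /eqP.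
  by rewrite lead_coef_eq0 => /eqP.
rewrite sr; suff [k k0 H] : exists2 k : R, 0 < k &
    forall z, 0 <= Im z -> k * (1 + N z) ^+ size r <= \prod_(w <- r) N (z - w).
  exists (N (lead_coef p) * k); first by rewrite mulr_gt0.
  by move=> z z0; rewrite E -mulrA ler_wpM2l ?normc_ge0 // H.
elim: r rl {pr sr E} => [|w r IH] rl.
  by exists 1 => // z _; rewrite big_nil mulr1.
have [|k k0 H] := IH; first by move=> z zr; apply: rl; rewrite inE zr orbT.
have wl := rl w (mem_head _ _).
have [k' k'0 H'] : exists2 k' : R, 0 < k' &
    forall z, 0 <= Im z -> k' * (1 + N z) <= N (z - w).
  have M0 := normc_ge0 w; set M := N w in M0.
  have d0 : 0 < 2 * M + 2 by lra.
  (* The first constant serves for [N z > 2 * M + 1], by the triangle inequality. The second serves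
     for smaller [z], where the imaginary part of [z - w] is at least [- Im w]. *)
  exists (Num.min (1 / 2) (- Im w / (2 * M + 2))).
    by rewrite lt_min !divr_gt0 ?oppr_gt0.
  move=> z z0; have z1 : 0 <= 1 + N z by rewrite addr_ge0 ?normc_ge0.
  have [le|gt] := lerP (N z) (2 * M + 1).
    apply: (@le_trans _ _ (- Im w / (2 * M + 2) * (1 + N z))).
      by rewrite ler_wpM2r // ge_min lexx orbT.
    apply: (@le_trans _ _ (- Im w)).
      rewrite -mulrA ger_pMr ?oppr_gt0 // mulrC ler_pdivrMr //; lra.
    have -> : - Im w = Im (z - w) - Im z by rewrite raddfB /=; lra.
    by have := normc_ge_Im (z - w); have := ler_norm (Im (z - w)); lra.
  apply: (@le_trans _ _ (1 / 2 * (1 + N z))).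
    by rewrite ler_wpM2r // ge_min lexx.
  have := normcD (z - w) w; rewrite subrK -/M; lra.
exists (k' * k); first exact: mulr_gt0.
move=> z z0; rewrite big_cons /= exprS mulrACA ler_pM ?H ?H' //.
  by rewrite mulr_ge0 ?addr_ge0 ?normc_ge0 // ltW.
by rewrite mulr_ge0 ?exprn_ge0 ?addr_ge0 ?normc_ge0 // ltW.
Qed.

(** The good values of [s] form a clopen set. It is open because the degree is constant and
    [lower_roots_bound] beats the change of the coefficients. It is closed because a root reaching
    the closed upper half-plane would have to cross the real axis. *)
Lemma lower_roots_homotopy (G : R -> {poly C}) n :
  (forall s, size (G s) = n.+1) ->
  (forall s0, exists2 B : R, 0 <= B & forall s k, `|s - s0| <= 1 ->
     N (G s - G s0)`_k <= B * `|s - s0|) ->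
  (forall s (u : R), ~~ root (G s) u%:C%C) ->
  lower_roots (G 0) -> forall s, lower_roots (G s).
Proof.
move=> sG cG nr G0.
have Gn0 s : G s != 0 by rewrite -size_poly_eq0 sG.
have ptw s0 : exists2 B : R, 0 < B & forall s z, `|s - s0| <= 1 ->
    N ((G s).[z] - (G s0).[z]) <= B * `|s - s0| * (1 + N z) ^+ n.
  have [B B0 HB] := cG s0; exists ((B + 1) * n.+1%:R).
    by rewrite mulr_gt0 // ltr_wpDl.
  move=> s z s1; rewrite -hornerN -hornerD [(B + 1) * _ * _]mulrAC.
  apply: horner_normc_bound.
  - by rewrite (leq_trans (size_polyD _ _)) // geq_max size_polyN !sG leqnn.
  - by rewrite mulr_ge0 // addr_ge0.
  - move=> k; apply: le_trans (HB s k s1) _.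
    by rewrite ler_wpM2r // lerDl.
have small (B e : R) : 0 < B -> 0 < e -> exists2 d : R, 0 < d & forall t,
    t < d -> t <= 1 /\ B * t < e.
  move=> B0 e0; exists (Num.min 1 (e / B)); first by rewrite lt_min ltr01 divr_gt0.
  move=> t; rewrite lt_min => /andP[t1 te]; split; first exact: ltW.
  by rewrite mulrC -ltr_pdivlMr.
apply: (clopen_real G0) => s0.
  move=> Gs0; have [k k0 Hk] := lower_roots_bound (Gn0 s0) Gs0.
  have [B B0 HB] := ptw s0; have [d d0 Hd] := small B k B0 k0.
  exists d => // s /Hd[s1 sk] z /eqP rz; rewrite ltNge; apply/negP => z0.
  have := HB s z s1; have := Hk z z0; rewrite rz sG /= add0r normcN => h1 h2.
  have := le_trans h1 h2; rewrite ler_pM2r ?exprn_gt0 ?ltr_wpDr ?normc_ge0 //.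
  by rewrite leNgt sk.
move=> nGs0; have [z [rz z0]] : exists z, root (G s0) z /\ 0 <= Im z.
  apply: contrapT => H; apply: nGs0 => z rz; rewrite ltNge; apply/negP => z0.
  by apply: H; exists z.
case: z rz z0 => u v /eqP rz /= v0.
(* [G s0] vanishes at [u + i v] but not at the real point [u] below it. If a nearby [G s] had only
   lower roots, its modulus at [u] would be at most the one at [u + i v]. This fails once both
   values are within half of [N (G s0).[u]] of those of [G s0]. *)
have eta0 : 0 < N (G s0).[u%:C%C].
  rewrite lt_def normc_ge0 andbT; apply/negP => /eqP /eq0_normc /eqP.
  exact/negP/nr.
have [B B0 HB] := ptw s0.
have [d1 d10 Hd1] := small (B * (1 + N u%:C%C) ^+ n) (N (G s0).[u%:C%C] / 2)
  (mulr_gt0 B0 (exprn_gt0 _ (ltr_wpDr (normc_ge0 _) ltr01))) (divr_gt0 eta0 (ltr0Sn _ _)).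
have [d2 d20 Hd2] := small (B * (1 + N (u +i* v)%C) ^+ n) (N (G s0).[u%:C%C] / 2)
  (mulr_gt0 B0 (exprn_gt0 _ (ltr_wpDr (normc_ge0 _) ltr01))) (divr_gt0 eta0 (ltr0Sn _ _)).
exists (Num.min d1 d2); first by rewrite lt_min d10.
move=> s; rewrite lt_min => /andP[/Hd1[s1 h1] /Hd2[_ h2]] Gs.
have [h3 _] := lower_roots_normc u (Gn0 s) Gs v0.
have := HB s u%:C%C s1; have := HB s (u +i* v)%C s1.
rewrite rz subr0 mulrAC => h4; rewrite mulrAC => h5.
have := normcD (- ((G s).[u%:C%C] - (G s0).[u%:C%C])) (G s).[u%:C%C].
rewrite opprB subrK -opprB normcN; lra.
Qed.

End ComplexRoots.

Lemma horner_inj (R : numDomainType) (P Q : {poly R}) :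
  (forall l, P.[l] = Q.[l]) -> P = Q.
Proof.
move=> PQ; apply/eqP; rewrite -subr_eq0; apply: contraT => D0.
pose rs : seq R := [seq i%:R | i <- iota 0 (size (P - Q))].
have := @max_poly_roots R (P - Q) rs D0.
rewrite size_map size_iota ltnn => -> //.
- by apply/allP => l _; rewrite /root hornerD hornerN PQ subrr.
- rewrite map_inj_uniq ?iota_uniq // => i j /eqP.
  by rewrite eqr_nat => /eqP.
Qed.

Lemma map_line_poly (R S T : comNzRingType) (f : {rmorphism R -> S})
    (g : {rmorphism S -> T}) d (q : mpoly d R) (u v : 'I_d -> S) :
  map_poly g (line_poly f q u v)
    = line_poly (g \o f) q (g \o u) (g \o v).
Proof.
rewrite /line_poly /mmap rmorph_sum /=; apply: eq_bigr => m _.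
rewrite rmorphM /= map_polyC /=; congr (_ * _).
rewrite /mmap1 rmorph_prod; apply: eq_bigr => i _.
by rewrite rmorphXn rmorphD /= linearZ /= map_polyC map_polyX.
Qed.

Lemma eq_line_poly (R S : comNzRingType) (f g : {rmorphism R -> S})
    d (q : mpoly d R) (u v u' v' : 'I_d -> S) :
  f =1 g -> u =1 u' -> v =1 v' -> line_poly f q u v = line_poly g q u' v'.
Proof.
move=> fg uu vv; rewrite /line_poly /mmap; apply: eq_bigr => m _ /=.
rewrite fg; congr (_ * _); rewrite /mmap1; apply: eq_bigr => i _.
by rewrite uu vv.
Qed.


Section Cone.
Variables (R : realType) (E : euclideanType R) (K : set E).
Hypotheses (convexK : convex_set K) (coneK : is_cone K).

Lemma cone_add (a b : E) : K a -> K b -> K (a + b).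
Proof.
move=> Ka Kb.
have H : K (2^-1 *: a + (1 - 2^-1) *: b).
  have h0 : 0 <= (2^-1 : R) by rewrite invr_ge0.
  have h1 : (2^-1 : R) <= 1 by rewrite invf_le1 // ler1n.
  by have := convexK (Itv01 h0 h1) (mem_set Ka) (mem_set Kb); rewrite in_setE.
have := coneK (ltr0Sn R 1) H.
rewrite scalerDr !scalerA.
have -> : 2 * (1 - 2^-1) = 1 :> R by lra.
have -> : 2 * 2^-1 = 1 :> R by lra.
by rewrite !scale1r.
Qed.

Lemma interior_cone_add (a b : E) (t : R) : 0 <= t -> K° a -> K° b -> K° (a + t *: b).
Proof.
rewrite le_eqVlt => /orP[/eqP <-|t0]; first by rewrite scale0r addr0.
move=> /nbhs_ballP[r /= r0 ar] /interior_subset Kb.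
apply/nbhs_ballP; exists r => // y.
rewrite -ball_normE /= => yr; rewrite -(subrK (t *: b) y).
apply: cone_add; last exact: coneK.
by apply: ar; rewrite -ball_normE /= opprB addrA.
Qed.

End Cone.

(** * Garding's theorem on the change of direction *)

Section Garding.
Variables (R : realType) (E : euclideanType R).
Implicit Types (K : set E) (p : E -> R) (e x y : E).

Definition coords x : 'I_(\dim {:E}) -> R := fun i => coord (vbasis {:E}) i x.

Lemma charpoly_line_poly n p (q : mpoly (\dim {:E}) R) e x :
  q \is ishomog1 n mdeg -> (forall x, p x = meval (coords x) q) ->
  charpoly p e x = line_poly idfun q (coords x) (coords (- e)).
Proof.
move=> qh pE; apply: horner_inj => l.
rewrite (@charpolyE _ _ n) ?horner_line_poly ?pE; last by exists q.
rewrite /meval; congr (mmap _ _ _); apply/funext => i.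
rewrite /coords linearB linearN /= [coord _ _ (l *: e)]linearZ /=.
by rewrite mulrN.
Qed.

Lemma homog_scale n p (t : R) x : homogeneous_poly n p -> p (t *: x) = t ^+ n * p x.
Proof.
case=> q qh pE; rewrite !pE -(mmap_homog idfun _ _ qh).
rewrite /meval; congr (mmap _ _ _); apply/funext => i.
by rewrite linearZ.
Qed.

(** The coefficient of rank [n] is [p (- e)], so the degree cannot drop. *)
Lemma charpoly_lead n p e x : homogeneous_poly n p -> p e != 0 ->
  size (charpoly p e x) = n.+1 /\ lead_coef (charpoly p e x) = (-1) ^+ n * p e.
Proof.
move=> hp pe; have [q qh pE] := hp.
have [sz cf] := size_coef_line_poly idfun (coords x) (coords (- e)) qh.
rewrite -(charpoly_line_poly e x qh pE) in sz cf.
have cfE : (charpoly p e x)`_n = (-1) ^+ n * p e.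
  by rewrite cf -(homog_scale _ _ hp) scaleN1r pE.
have sE : size (charpoly p e x) = n.+1.
  apply/eqP; rewrite eqn_leq sz ltnNge; apply/negP => le.
  move/leq_sizeP: le => /(_ n (leqnn n)) /eqP.
  by rewrite cfE mulf_eq0 signr_eq0 (negbTE pe).
by rewrite lead_coefE sE.
Qed.

(** Making [s] a formal variable gives [H], whose coefficients evaluated at [s] are those of [G s].
    These are thus polynomial in [s], and only the first [n.+1] can be nonzero. *)
Lemma line_poly_lipschitz (q : mpoly (\dim {:E}) R) (a b c : 'I_(\dim {:E}) -> R[i]) n :
  q \is ishomog1 n mdeg ->
  let G (s : R) := line_poly (real_complex R) q (fun i => a i + s%:C%C * b i) c in
  forall s0, exists2 B : R, 0 <= B & forall s k, `|s - s0| <= 1 ->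
     normc (G s - G s0)`_k <= B * `|s - s0|.
Proof.
move=> qh G s0.
pose H : {poly {poly R[i]}} := line_poly (@polyC R[i] \o real_complex R) q
  (fun i => (a i)%:P + b i *: 'X) (fun i => (c i)%:P).
have GE s : G s = map_poly (horner_eval s%:C%C) H.
  rewrite map_line_poly; apply: eq_line_poly => i /=; rewrite /horner_eval ?hornerE //.
  by rewrite mulrC.
have : exists2 B : R[i], 0 <= B & forall k (s : R), (k < n.+1)%N -> `|s - s0| <= 1 ->
    `|(G s - G s0)`_k| <= B * `|s - s0|%:C%C.
  elim: (n.+1) => [|m [B B0 HB]]; first by exists 0.
  have [C C0 HC] := horner_lipschitz H`_m s0%:C%C.
  exists (B + C); first by rewrite addr_ge0.
  move=> k s; rewrite ltnS leq_eqVlt => /orP[/eqP ->|km] s1; last first.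
    apply: le_trans (HB k s km s1) _; rewrite ler_wpM2r ?ler0c //.
    by rewrite lerDl.
  have nE : `|(s - s0)%:C%C| = `|s - s0|%:C%C.
    by rewrite normc_def /= expr0n addr0 sqrtr_sqr.
  have sE : s0%:C%C + (s - s0)%:C%C = s%:C%C by rewrite -rmorphD addrC subrK.
  have := HC (s - s0)%:C%C; rewrite nE sE -[1]/(1%:C)%C lecR => /(_ s1) h.
  rewrite coefB !GE !coef_map /=; apply: le_trans h _.
  by rewrite ler_wpM2r ?ler0c // lerDr.
case=> B B0 HB; exists (complex.Re B).
  by move: B0; rewrite lecE => /andP[].
move=> s k s1; have [kn|kn] := ltnP k n.+1; last first.
  rewrite nth_default ?normc0 ?mulr_ge0 //.
    by move: B0; rewrite lecE => /andP[].
  apply: leq_trans (size_polyD _ _) _; rewrite size_polyN geq_max.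
  by rewrite !(leq_trans _ kn) // (proj1 (size_coef_line_poly _ _ _ qh)).
have BE : B = (complex.Re B)%:C%C by rewrite RRe_real // ger0_real.
have := HB k s kn s1; rewrite BE.
by rewrite -rmorphM -[`|_|]/(normc _)%:C%C lecR.
Qed.

(** The last assumption says that the eigenvalues of [e] in the direction [e'] are positive. The
    conclusion is a limit of nonvanishing statements, so these are proved as a quantitative lower
    bound, which passes to the limit. *)
Lemma garding n p e e' : homogeneous_poly n p ->
  (forall x, only_real_roots (charpoly p e' x)) -> p e' != 0 ->
  (forall r : R, 0 <= r -> p (e + r *: e') != 0) ->
  forall x, only_real_roots (charpoly p e x).
Proof.
move=> hp rr' pe' pK x.
have pe : p e != 0 by have := pK 0 (lexx 0); rewrite scale0r addr0.
have [q qh pE] := hp.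
pose toC : {rmorphism R -> R[i]} := real_complex R.
pose pC (z : 'I_(\dim {:E}) -> R[i]) : R[i] := mmap toC z q.
pose cC y : 'I_(\dim {:E}) -> R[i] := fun i => (coords y i)%:C%C.
have charE (f : E) y z : (map_poly toC (charpoly p f y)).[z]
    = pC (fun i => cC y i - z * cC f i).
  rewrite (charpoly_line_poly f y qh pE) map_line_poly horner_line_poly.
  rewrite /pC; congr (mmap _ _ _); apply/funext => i /=.
  by rewrite /coords linearN /= rmorphN mulrN.
have pCr y : pC (cC y) = (p y)%:C%C.
  have := charE 0 y 0; rewrite horner_coef0 coef_map -horner_coef0.
  rewrite (charpolyE _ _ _ hp) scaler0 subr0 /= => ->.
  by congr (pC _); apply/funext => i; rewrite mul0r subr0.
pose G (s : R) := line_poly toC q (fun i => 'i%C * cC e' i + s%:C%C * cC x i) (cC e).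
have GE s z : (G s).[z] = pC (fun i => 'i%C * cC e' i + s%:C%C * cC x i + z * cC e i).
  by rewrite horner_line_poly.
have Gn s : size (G s) = n.+1 /\ lead_coef (G s) = (p e)%:C%C.
  have [sz cf] := size_coef_line_poly toC
    (fun i => 'i%C * cC e' i + s%:C%C * cC x i) (cC e) qh.
  have sE : size (G s) = n.+1.
    apply/eqP; rewrite eqn_leq sz ltnNge; apply/negP => /leq_sizeP /(_ n (leqnn n)).
    rewrite cf -/(pC (cC e)) pCr => /complexI /eqP.
    exact/negP.
  by rewrite lead_coefE sE cf -/(pC (cC e)) pCr.
have nI (l : R) : 'i%C = l%:C%C -> False by case=> _ /eqP; rewrite oner_eq0.
have Gs : forall s, lower_roots (G s).
  apply: (@lower_roots_homotopy _ _ n).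
  - by move=> s; have [] := Gn s.
  - exact: line_poly_lipschitz qh.
  (* A real root [u] would make [- 'i] an eigenvalue of [s x + u e] in the direction [e']. *)
  - move=> s u; apply/negP => /eqP; rewrite GE => r0.
    have /complex_realP[l] : - 'i%C \is @Num.real R[i].
      apply: (rr' (s *: x + u *: e)); apply/eqP; rewrite charE -[RHS]r0.
      congr (pC _); apply/funext => i; rewrite /cC /coords linearD /=.
      rewrite [coord _ _ (s *: x)]linearZ [coord _ _ (u *: e)]linearZ /=.
      by rewrite rmorphD !rmorphM /=; ring.
    by rewrite -[RHS]opprK -rmorphN => /oppr_inj /nI.
  (* At [s = 0], homogeneity turns a root [t] into the eigenvalue [l = - 'i / t] of [e] in the
     direction [e']. It is real and positive, hence [t = - 'i / l] is in the lower half-plane. *)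
  - move=> t /eqP; rewrite GE => r0.
    have {}r0 : pC (fun i => 'i%C * cC e' i + t * cC e i) = 0.
      rewrite -[RHS]r0; congr (pC _); apply/funext => i.
      by rewrite -[(0 : R)%:C%C]/(0 : R[i]) mul0r addr0.
    have t0 : t != 0.
      apply: contraNneq pe' => t0; move: r0; rewrite t0.
      rewrite (_ : (fun i => _) = (fun i => 'i%C * cC e' i)); last first.
        by apply/funext => i; rewrite mul0r addr0.
      rewrite /pC (mmap_homog _ _ _ qh) -/(pC (cC e')) pCr => /eqP.
      rewrite mulf_eq0 expf_eq0 => /orP[/andP[_ /eqP]|/eqP /complexI -> //].
      by case=> /eqP; rewrite oner_eq0.
    have rt : root (map_poly toC (charpoly p e' e)) (- 'i%C / t).
      apply/eqP; rewrite charE; apply: (mulfI (expf_neq0 n t0)).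
      rewrite mulr0 -[RHS]r0 /pC -(mmap_homog _ _ _ qh).
      congr (mmap _ _ _); apply/funext => i; field.
      exact: t0.
    have /complex_realP[l lE] := rr' e _ rt.
    have l0 : 0 < l.
      rewrite ltNge; apply/negP => l0.
      have := pK (- l); rewrite oppr_ge0 => /(_ l0).
      rewrite scaleNr -(charpolyE _ _ _ hp) -(fmorph_eq0 toC) -horner_map.
      by move: rt; rewrite lE /root => ->.
    have -> : t = (0 -i* l^-1)%C.
      have lC0 : l%:C%C != 0 :> R[i] by rewrite -(rmorph0 toC) (inj_eq (@complexI R)) gt_eqF.
      have : t * l%:C%C = - 'i%C by rewrite -lE mulrC divfK.
      move=> /(congr1 (fun z => z / l%:C%C)); rewrite mulfK // => ->.
      rewrite -fmorphV /=; simpc; by [].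
    by rewrite /= oppr_lt0 invr_gt0.
(* By homogeneity, [p (x + (u + i v) e + a i e')] is [a ^+ n] times the value of [G a^-1] at
   [(u + i v) / a]. The powers of [a] cancel in the bound of [lower_roots_normc], which therefore
   survives as [a] tends to [0]. *)
have key (u v : R) : 0 <= v -> `|p e| * v ^+ n
    <= normc (pC (fun i => cC x i + (u +i* v)%C * cC e i)).
  move=> v0; pose H := line_poly toC q
    (fun i => cC x i + (u +i* v)%C * cC e i) (fun i => 'i%C * cC e' i).
  have HE z : H.[z] = pC (fun i => cC x i + (u +i* v)%C * cC e i + z * ('i%C * cC e' i)).
    by rewrite horner_line_poly.
  have hH (a : R) : 0 < a -> `|p e| * v ^+ n <= normc H.[a%:C%C].
    move=> a0; have [sG lG] := Gn a^-1.
    have G0 : G a^-1 != 0 by rewrite -size_poly_eq0 sG.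
    have va : 0 <= v / a by rewrite divr_ge0 // ltW.
    have [_] := lower_roots_normc (u / a) G0 (Gs _) va.
    have aC0 : a%:C%C != 0 :> R[i] by rewrite -(rmorph0 toC) (inj_eq (@complexI R)) gt_eqF.
    rewrite sG lG normc_real GE /= => h.
    have -> : H.[a%:C%C] = a%:C%C ^+ n * pC (fun i => 'i%C * cC e' i
        + (a^-1)%:C%C * cC x i + (u / a +i* (v / a))%C * cC e i).
      rewrite HE /pC -(mmap_homog _ _ _ qh); congr (mmap _ _ _); apply/funext => i.
      have -> : (u / a +i* (v / a))%C = (u +i* v)%C / a%:C%C.
        by rewrite -fmorphV /=; simpc.
      rewrite [(a^-1)%:C%C]fmorphV /=; field; exact: aC0.
    rewrite normcM normcX normc_real (gtr0_norm a0).
    have an : 0 < a ^+ n by rewrite exprn_gt0.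
    rewrite [leLHS](_ : _ = a ^+ n * (`|p e| * (v / a) ^+ n)).
      by apply: ler_wpM2l => //; exact: ltW.
    by rewrite expr_div_n; field; rewrite gt_eqF.
  have -> : pC (fun i => cC x i + (u +i* v)%C * cC e i) = H.[0].
    by rewrite HE; congr (pC _); apply/funext => i; rewrite mul0r addr0.
  have [B B0 HB] := horner_lipschitz H 0.
  have Bn : B = (complex.Re B)%:C%C by rewrite RRe_real // ger0_real.
  have B'0 : 0 <= complex.Re B by move: B0; rewrite {1}Bn ler0c.
  apply/ler_addgt0Pr => eps eps0.
  pose a : R := Num.min 1 (eps / (complex.Re B + 1)).
  have a0 : 0 < a by rewrite lt_min ltr01 divr_gt0 // ltr_wpDl.
  have a1 : a <= 1 by rewrite ge_min lexx.
  have aB : complex.Re B * a <= eps.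
    apply: (@le_trans _ _ ((complex.Re B + 1) * a)).
      by rewrite ler_wpM2r ?(ltW a0) // lerDl.
    by rewrite mulrC -ler_pdivlMr ?ltr_wpDl // ge_min lexx orbT.
  have nE : `|a%:C%C| = a%:C%C by rewrite ger0_norm // ler0c ltW.
  have := HB a%:C%C; rewrite nE add0r -[1]/(1%:C)%C lecR => /(_ a1).
  rewrite Bn -rmorphM -[`|_|]/(normc _)%:C%C lecR => h.
  have := hH a a0; have := normcD (H.[a%:C%C] - H.[0]) H.[0].
  rewrite subrK; lra.
(* [key] at [- (u + i v)] excludes roots with [v < 0]; conjugation then excludes those with
   [v > 0]. *)
have none (u v : R) : root (map_poly toC (charpoly p e x)) (u +i* v)%C -> 0 <= v.
  move=> /eqP; rewrite charE => r0; rewrite leNgt; apply/negP => v0.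
  have nv : 0 <= - v by rewrite oppr_ge0 ltW.
  have := key (- u) _ nv.
  rewrite (_ : (fun i => _) = (fun i => cC x i - (u +i* v)%C * cC e i)); last first.
    by apply/funext => i; rewrite -mulNr.
  rewrite r0 normc0 leNgt mulr_gt0 ?normr_gt0 // exprn_gt0 // oppr_gt0 //.
move=> [u v] rz; rewrite complex_real.
have h2 : root (map_poly toC (charpoly p e x)) (u +i* (- v))%C.
  rewrite -[(u +i* - v)%C]/((u +i* v)^*)%C -complex_root_conj -map_poly_comp.
  rewrite (eq_map_poly (g := toC)) // => l.
  by rewrite /= /toC /= oppr0.
by rewrite eq_le (none _ _ rz) -oppr_ge0 (none _ _ h2).
Qed.

End Garding.

(** * Second order expansions *)

Section QuadraticExpansion.
Variables (R : realType) (E : euclideanType R).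
Implicit Types (f : E -> R) (x g h : E).

Lemma innerC x y : inner x y = inner y x :> R.
Proof. by rewrite hermC /= expr0 mul1r. Qed.

Lemma inner_le x y : `|inner x y| <= `|x| * `|y| :> R.
Proof.
have D (a b : E) : inner (a + b) (a + b) = inner a a + 2 * inner a b + inner b b :> R.
  by rewrite linearDl /= !linearDr /= (innerC b a); ring.
have H (a b : E) : inner a b <= `|a| * `|b| :> R.
  have := D a b; rewrite !inner_normE => Dab.
  have : `|a + b| ^+ 2 <= (`|a| + `|b|) ^+ 2.
    by rewrite lerXn2r ?nnegrE ?addr_ge0 // ler_normD.
  by rewrite Dab sqrrD; lra.
rewrite ler_norml H andbT lerNl -linearNr /=; apply: le_trans (H _ _) _.
by rewrite normrN.
Qed.

Lemma inner_eq0 x : (forall y, inner x y = 0 :> R) -> x = 0.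
Proof.
by move=> /(_ x); rewrite inner_normE => /eqP; rewrite expf_eq0 /= normr_eq0 => /eqP.
Qed.

(** The dual basis for the inner product. The map [F] is injective because a vector orthogonal to
    the basis is zero, hence it is invertible, and the preimage of
    [b]_i[under]F[has inner product]1[with]b[_i] and [0] with the other basis vectors. *)
Lemma coord_inner (i : 'I_(\dim {:E})) :
  exists g : E, forall x, coord (vbasis {:E}) i x = inner g x.
Proof.
pose b := vbasis {:E}.
pose T : E -> E := fun x => \sum_(k < \dim {:E}) inner x b`_k *: b`_k.
have Tlin : linear T.
  move=> a u v; rewrite /T scaler_sumr -big_split; apply: eq_bigr => k _ /=.
  by rewrite linearDl /= linearZl_LR /= scalerDl scalerA.
pose TL : {linear E -> E} := HB.pack T (GRing.isLinear.Build _ _ _ _ T Tlin).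
pose F : 'End(E) := linfun TL.
have FE x : F x = \sum_(k < \dim {:E}) inner x b`_k *: b`_k by rewrite lfunE.
have bf : free b by exact: basis_free (vbasisP _).
have xE x : x = \sum_(k < \dim {:E}) coord b k x *: b`_k.
  by apply: coord_vbasis; rewrite memvf.
have K0 : lker F == 0%VS.
  apply/eqP/eqP; rewrite -subv0; apply/subvP => x; rewrite memv_ker FE memv0 => /eqP H.
  apply/eqP/inner_eq0 => y; rewrite (xE y) linear_sum /= big1 // => k _.
  rewrite linearZr_LR /=.
  have -> : inner x b`_k = coord b k (\sum_(k < \dim {:E}) inner x b`_k *: b`_k) :> R.
    by rewrite coord_sum_free.
  by rewrite H linear0 mulr0.
exists (F^-1%VF b`_i) => x.
have := lker0_lfunVK K0 b`_i; rewrite FE; set g := F^-1%VF _ => H.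
rewrite {2}(xE x) linear_sum /= (bigD1 i) //= big1 ?addr0.
  rewrite linearZr_LR /=.
  have -> : inner g b`_i = coord b i b`_i :> R by rewrite -{2}H coord_sum_free.
  by rewrite coord_free // eqxx mulr1.
move=> k ki; rewrite linearZr_LR /=.
have -> : inner g b`_k = coord b k b`_i :> R by rewrite -H coord_sum_free.
by rewrite coord_free // eq_sym (negbTE ki) mulr0.
Qed.

(** First-order expansion with a quadratic remainder. It is stable under sums and products like
    differentiability, and at a minimum, where [g = 0], it yields the bound [O(|h|^2)] from which
    eigenvalues are seen to move by [O(|h|)]. *)
Definition quad_at f x g := exists2 C : R, 0 <= C &
  \forall h \near (0 : E), `|f (x + h) - f x - inner g h| <= C * `|h| ^+ 2.

Definition smooth_at f x := exists g, quad_at f x g.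

Lemma quad_at_cst (c : R) x : quad_at (cst c) x 0.
Proof.
exists 0 => //; near=> h; by rewrite /cst subrr linear0l subrr normr0 mul0r.
Unshelve. all: by end_near. Qed.

Lemma quad_at_coord (i : 'I_(\dim {:E})) x : smooth_at (coord (vbasis {:E}) i) x.
Proof.
have [g gE] := coord_inner i; exists g; exists 0 => //; near=> h.
by rewrite !gE linearDr /= mul0r [X in `|X|](_ : _ = 0) ?normr0 //; ring.
Unshelve. all: by end_near. Qed.

Lemma quad_at_lip f x g : quad_at f x g -> exists2 C : R, 0 <= C &
  \forall h \near (0 : E), `|f (x + h) - f x| <= C * `|h|.
Proof.
case=> C C0 HC; exists (C + `|g|); first exact: addr_ge0.
near=> h.
have h1 : `|h| <= 1 by near: h; exact: nbhs0_le.
have : `|f (x + h) - f x - inner g h| <= C * `|h| ^+ 2 by near: h.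
have := inner_le g h; have := ler_normD (f (x + h) - f x - inner g h) (inner g h).
rewrite subrK; have : C * `|h| ^+ 2 <= C * `|h|.
  by rewrite ler_wpM2l // expr2 ler_piMr.
by rewrite mulrDl; lra.
Unshelve. all: by end_near. Qed.

Lemma quad_atD f1 f2 x g1 g2 : quad_at f1 x g1 -> quad_at f2 x g2 ->
  quad_at (fun y => f1 y + f2 y) x (g1 + g2).
Proof.
case=> C1 C10 H1 [C2 C20 H2]; exists (C1 + C2); first exact: addr_ge0.
near=> h; rewrite linearDl /=.
have : `|f1 (x + h) - f1 x - inner g1 h| <= C1 * `|h| ^+ 2 by near: h.
have : `|f2 (x + h) - f2 x - inner g2 h| <= C2 * `|h| ^+ 2 by near: h.
have := ler_normD (f1 (x + h) - f1 x - inner g1 h) (f2 (x + h) - f2 x - inner g2 h).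
rewrite mulrDl.
rewrite (_ : f1 (x + h) - f1 x - inner g1 h + (f2 (x + h) - f2 x - inner g2 h)
  = f1 (x + h) + f2 (x + h) - (f1 x + f2 x) - (inner g1 h + inner g2 h)); last by ring.
lra.
Unshelve. all: by end_near. Qed.

Lemma quad_atM f1 f2 x g1 g2 : quad_at f1 x g1 -> quad_at f2 x g2 ->
  quad_at (fun y => f1 y * f2 y) x (f1 x *: g2 + f2 x *: g1).
Proof.
move=> Q1 Q2; have [L1 L10 K1] := quad_at_lip Q1; have [L2 L20 K2] := quad_at_lip Q2.
case: Q1 Q2 => C1 C10 H1 [C2 C20 H2].
exists (`|f1 x| * C2 + `|f2 x| * C1 + L1 * L2).
  by rewrite !addr_ge0 // mulr_ge0.
near=> h; rewrite linearDl /= !linearZl_LR /=.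
have a1 : `|f1 (x + h) - f1 x - inner g1 h| <= C1 * `|h| ^+ 2 by near: h.
have a2 : `|f2 (x + h) - f2 x - inner g2 h| <= C2 * `|h| ^+ 2 by near: h.
have b1 : `|f1 (x + h) - f1 x| <= L1 * `|h| by near: h.
have b2 : `|f2 (x + h) - f2 x| <= L2 * `|h| by near: h.
rewrite (_ : _ - _ - _ = f1 x * (f2 (x + h) - f2 x - inner g2 h)
  + f2 x * (f1 (x + h) - f1 x - inner g1 h)
  + (f1 (x + h) - f1 x) * (f2 (x + h) - f2 x)); last by ring.
rewrite [leRHS]mulrDl; apply: le_trans (ler_normD _ _) _; apply: lerD; last first.
  by rewrite normrM expr2 mulrACA ler_pM.
rewrite [leRHS]mulrDl; apply: le_trans (ler_normD _ _) _.
by apply: lerD; rewrite normrM -mulrA ler_wpM2l.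
Unshelve. all: by end_near. Qed.

Lemma smooth_at_cst (c : R) x : smooth_at (fun=> c) x.
Proof. by exists 0; exact: quad_at_cst. Qed.

Lemma smooth_atD f1 f2 x : smooth_at f1 x -> smooth_at f2 x ->
  smooth_at (fun y => f1 y + f2 y) x.
Proof. by case=> g1 H1 [g2 H2]; exists (g1 + g2); exact: quad_atD. Qed.

Lemma smooth_atM f1 f2 x : smooth_at f1 x -> smooth_at f2 x ->
  smooth_at (fun y => f1 y * f2 y) x.
Proof. by case=> g1 H1 [g2 H2]; eexists; exact: quad_atM H1 H2. Qed.

Lemma smooth_at_sum (I : eqType) (r : seq I) (F : I -> E -> R) x :
  (forall i, i \in r -> smooth_at (F i) x) ->
  smooth_at (fun y => \sum_(i <- r) F i y) x.
Proof.
elim: r => [|i r IH] H.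
  rewrite (_ : (fun y => _) = fun=> 0); first exact: smooth_at_cst.
  by apply/funext => y; rewrite big_nil.
rewrite (_ : (fun y => _) = fun y => F i y + \sum_(i <- r) F i y).
  apply: smooth_atD; first by apply: H; rewrite mem_head.
  by apply: IH => j jr; apply: H; rewrite inE jr orbT.
by apply/funext => y; rewrite big_cons.
Qed.

Lemma quad_at_gradient f x g : quad_at f x g -> is_gradient f x g.
Proof.
move=> [C C0 HC].
have L : linear (inner g : E -> R^o) by move=> a u v; rewrite linearPr.
pose df : {linear E -> R^o} := HB.pack (inner g : E -> R^o) (GRing.isLinear.Build _ _ _ _ _ L).
have cdf : continuous df.
  apply: bounded_linear_continuous; apply/linear_boundedP; exists (`|g| + 1); split=> //.
  move=> r rg y; apply: le_trans (inner_le g y) _; rewrite ler_wpM2r //; lra.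
have fE : (f : E -> R^o) \o shift x = cst (f x : R^o) + df +o_ (0 : E) id.
  have C1 : 0 < C + 1 by lra.
  apply/eqaddoP => _/posnumP[eps]; near=> h.
  rewrite (_ : (_ - _) h = f (x + h) - f x - inner g h); last first.
    by rewrite -[LHS]/(f (h + x) - (f x + inner g h)) [h + x]addrC opprD addrA.
  have h1 : `|f (x + h) - f x - inner g h| <= C * `|h| ^+ 2 by near: h.
  apply: le_trans h1 _; rewrite expr2 mulrA ler_wpM2r //.
  have h2 : `|h| <= eps%:num / (C + 1).
    by near: h; apply: nbhs0_le; exact: divr_gt0.
  apply: (@le_trans _ _ ((C + 1) * `|h|)); first by rewrite ler_wpM2r // lerDl.
  by rewrite mulrC -ler_pdivlMr.
have dE := diff_unique cdf fE.
split; last by move=> v; rewrite dE.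
by apply/diff_locallyP; rewrite dE; split.
Unshelve. all: by end_near. Qed.

(** Moving from the zero [x] by [- t *: g] changes [f] by [- t |g|^2] up to [C t^2 |g|^2], which is
    negative for small [t > 0] unless [g = 0]. *)
Lemma quad_at_min f x g : quad_at f x g -> f x = 0 -> (forall y, 0 <= f y) -> g = 0.
Proof.
case=> C C0 HC fx f0; apply/eqP; rewrite -normr_eq0; apply/eqP.
apply/le_anti; rewrite normr_ge0 andbT leNgt; apply/negP => g0.
have /nbhs_norm0P[/= d d0 Hd] := HC.
(* The first bound keeps [- t *: g] in the ball where the expansion holds; the second gives
   [t * (C + 1) < 1]. *)
pose t : R := Num.min (d / (2 * `|g|)) (1 / (2 * (C + 1))).
have C1 : 0 < 2 * (C + 1) by rewrite mulr_gt0 // ltr_wpDl.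
have t0 : 0 < t by rewrite lt_min !divr_gt0 // mulr_gt0.
have td : `|- t *: g| < d.
  rewrite normrZ normrN gtr0_norm //.
  apply: (@le_lt_trans _ _ (d / (2 * `|g|) * `|g|)).
    by rewrite ler_wpM2r // ge_min lexx.
  have -> : d / (2 * `|g|) * `|g| = d / 2 by field; rewrite gt_eqF.
  by lra.
have := Hd _ td; rewrite fx subr0 linearZr_LR /= inner_normE normrZ normrN (gtr0_norm t0).
have := f0 (x - t *: g); rewrite -scaleNr => h1 h2.
have h3 := ler_norm (f (x + - t *: g) - - t * `|g| ^+ 2).
have h4 : t * `|g| ^+ 2 <= C * (t * `|g|) ^+ 2 by lra.
have h5 : t * (C + 1) < 1.
  apply: (@le_lt_trans _ _ (1 / (2 * (C + 1)) * (C + 1))).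
    by rewrite ler_wpM2r ?addr_ge0 // ge_min lexx orbT.
  have -> : 1 / (2 * (C + 1)) * (C + 1) = 1 / 2 by field; lra.
  by lra.
have h6 : 0 < t * `|g| ^+ 2 by rewrite mulr_gt0 // exprn_gt0.
have h7 : C * (t * `|g|) ^+ 2 = t * C * (t * `|g| ^+ 2) by ring.
have h8 : t * C * (t * `|g| ^+ 2) <= (1 - t) * (t * `|g| ^+ 2).
  by apply: ler_wpM2r; [exact: ltW|lra].
have h9 : 0 < t * (t * `|g| ^+ 2) by rewrite mulr_gt0.
lra.
Qed.

End QuadraticExpansion.

(** * Perturbation of eigenvalues *)

Section SmoothCoefficients.
Variables (R : realType) (E : euclideanType R) (x0 : E).
Implicit Types (P Q : E -> {poly R}).

Definition smooth_coefs P := forall k, smooth_at (fun y => (P y)`_k) x0.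

Lemma smooth_coefsM P Q : smooth_coefs P -> smooth_coefs Q ->
  smooth_coefs (fun y => P y * Q y).
Proof.
move=> HP HQ k.
rewrite (_ : (fun y => _) = fun y => \sum_(j <- index_enum 'I_k.+1) (P y)`_j * (Q y)`_(k - j)).
  by apply: smooth_at_sum => j _; exact: smooth_atM.
by apply/funext => y; rewrite coefM.
Qed.

Lemma smooth_coefs_cst (P : {poly R}) : smooth_coefs (fun=> P).
Proof. by move=> k; exact: smooth_at_cst. Qed.

Lemma smooth_coefs_sum (I : eqType) (r : seq I) (F : I -> E -> {poly R}) :
  (forall i, smooth_coefs (F i)) -> smooth_coefs (fun y => \sum_(i <- r) F i y).
Proof.
move=> H k; rewrite (_ : (fun y => _) = fun y => \sum_(i <- r) (F i y)`_k).
  by apply: smooth_at_sum => i _; exact: H.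
by apply/funext => y; rewrite coef_sum.
Qed.

Lemma smooth_coefs_prod (I : Type) (r : seq I) (F : I -> E -> {poly R}) :
  (forall i, smooth_coefs (F i)) -> smooth_coefs (fun y => \prod_(i <- r) F i y).
Proof.
move=> H; elim: r => [|i r IH].
  rewrite (_ : (fun y => _) = fun=> 1); first exact: smooth_coefs_cst.
  by apply/funext => y; rewrite big_nil.
rewrite (_ : (fun y => _) = fun y => F i y * \prod_(i <- r) F i y).
  exact: smooth_coefsM.
by apply/funext => y; rewrite big_cons.
Qed.

Lemma smooth_coefsX P m : smooth_coefs P -> smooth_coefs (fun y => P y ^+ m).
Proof.
move=> H; elim: m => [|m IH]; first exact: smooth_coefs_cst.
rewrite (_ : (fun y => _) = fun y => P y * P y ^+ m); first exact: smooth_coefsM.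
by apply/funext => y; rewrite exprS.
Qed.

Lemma smooth_charpoly n p e : homogeneous_poly n p -> smooth_coefs (charpoly p e).
Proof.
case=> q qh pE.
rewrite (_ : charpoly p e = fun y => line_poly idfun q (coords y) (coords (- e))).
  apply: smooth_coefs_sum => m; apply: smooth_coefsM; first exact: smooth_coefs_cst.
  apply: smooth_coefs_prod => i.
  apply: smooth_coefsX => k.
  rewrite (_ : (fun y => _) = fun y => coords y i * (k == 0%N)%:R
     + (coords (- e) i *: 'X)`_k).
    apply: smooth_atD; last exact: smooth_at_cst.
    by apply: smooth_atM; [exact: quad_at_coord|exact: smooth_at_cst].
  apply/funext => y; rewrite coefD coefC; case: eqP => _; rewrite ?mulr1 ?mulr0 //.
by apply/funext => y; exact: charpoly_line_poly qh pE.
Qed.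

End SmoothCoefficients.

Section Eigenvalues.
Variables (R : realType) (E : euclideanType R) (n : nat) (p : E -> R) (e : E).
Hypotheses (hp : homogeneous_poly n p) (pe : p e != 0).
Hypothesis rr : forall x, only_real_roots (charpoly p e x).
Let c := (-1) ^+ n * p e.

Let c0 : c != 0.
Proof. by rewrite mulf_neq0 // signr_eq0. Qed.

Lemma eigenvalues_perm y lam : uniq lam ->
  (forall l, (l \in lam) = root (charpoly p e y) l) ->
  perm_eq (eigenvalues p e y) (flatten [seq nseq (mup l (charpoly p e y)) l | l <- lam]).
Proof.
have [sP lP] := charpoly_lead y hp pe.
have P0 : charpoly p e y != 0 by rewrite -size_poly_eq0 sP.
have [s sE] := split_real_roots P0 (@rr y).
have lc : lead_coef (charpoly p e y) != 0 by rewrite lead_coef_eq0.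
move=> ul lamP; apply: perm_trans (perm_roots lc sE ul lamP).
rewrite perm_sym; apply: (perm_roots lc sE); first exact: uniq_roots.
move=> l; rewrite -(roots_on_rootsR P0) //.
Qed.

Lemma charpoly_prod y :
  charpoly p e y = c *: \prod_(z <- eigenvalues p e y) ('X - z%:P).
Proof.
have [sP lP] := charpoly_lead y hp pe.
have P0 : charpoly p e y != 0 by rewrite -size_poly_eq0 sP.
have [s sE] := split_real_roots P0 (@rr y).
have lc : lead_coef (charpoly p e y) != 0 by rewrite lead_coef_eq0.
rewrite {1}sE lP; congr (_ *: _); apply: perm_big.
apply: (perm_roots lc sE); first exact: uniq_roots.
by move=> l; rewrite -(roots_on_rootsR P0) //.
Qed.

Lemma size_eigenvalues y : size (eigenvalues p e y) = n.
Proof.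
have [sP _] := charpoly_lead y hp pe; apply/succn_inj.
by rewrite -sP charpoly_prod size_scale // size_prod_XsubC.
Qed.

(** Up to the factor [c^-1], the coefficients of [rev_charpoly] are those of the characteristic
    polynomial, hence smooth. The coefficient of rank [0] being [1], Newton's identity can be solved
    for the power sum of order [k] in terms of lower ones. *)
Lemma smooth_psum x k : smooth_at (fun y => psum (eigenvalues p e y) k) x.
Proof.
have sD j : smooth_at (fun y => (rev_charpoly (eigenvalues p e y))`_j) x.
  have [jn|nj] := leqP j n.
    rewrite (_ : (fun y => _) = fun y => c^-1 * (charpoly p e y)`_(n - j)).
      by apply: smooth_atM; [exact: smooth_at_cst|exact: (smooth_charpoly _ _ hp)].
    apply/funext => y; rewrite coef_rev_charpoly ?size_eigenvalues // charpoly_prod coefZ.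
    by rewrite mulKf.
  rewrite (_ : (fun y => _) = fun=> 0); first exact: smooth_at_cst.
  apply/funext => y; rewrite nth_default //.
  by apply: leq_trans (size_rev_charpoly _) _; rewrite size_eigenvalues.
elim/ltn_ind: k => k IH.
rewrite (_ : (fun y => _) = fun y =>
  (n%:R - k%:R) * (rev_charpoly (eigenvalues p e y))`_k
  + \sum_(j <- index_enum 'I_k) - ((rev_charpoly (eigenvalues p e y))`_(lift ord0 j)
     * psum (eigenvalues p e y) (k - lift ord0 j))).
  apply: smooth_atD; first by apply: smooth_atM => //; exact: smooth_at_cst.
  apply: smooth_at_sum => j _.
  rewrite (_ : (fun y => _) = fun y => -1 * ((rev_charpoly (eigenvalues p e y))`_(lift ord0 j)
     * psum (eigenvalues p e y) (k - lift ord0 j))); last first.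
    by apply/funext => y; rewrite mulN1r.
  apply: smooth_atM; first exact: smooth_at_cst.
  apply: smooth_atM => //; apply: IH.
  by rewrite lift0 ltn_subrL /= (leq_ltn_trans _ (ltn_ord j)).
apply/funext => y; rewrite sumrN -(size_eigenvalues y) -newton_identity big_ord_recl.
rewrite addrK subn0 -horner_coef0 /rev_charpoly horner_prod big1 ?mul1r // => z _.
by rewrite !hornerE subr0.
Qed.

Lemma smooth_horner_sum x (q : {poly R}) :
  smooth_at (fun y => \sum_(z <- eigenvalues p e y) q.[z]) x.
Proof.
rewrite (_ : (fun y => _) = fun y => \sum_(k <- index_enum 'I_(size q))
   q`_k * psum (eigenvalues p e y) k).
  apply: smooth_at_sum => k _; apply: smooth_atM; first exact: smooth_at_cst.
  exact: smooth_psum.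
apply/funext => y; rewrite -[RHS]/(\sum_(k < size q) _).
under eq_bigr do rewrite horner_coef.
by rewrite exchange_big /=; apply: eq_bigr => k _; rewrite /psum mulr_sumr.
Qed.

End Eigenvalues.

Lemma near_all_in (T : Type) (F : set_system T) (I : eqType) (s : seq I)
    (P : I -> T -> Prop) : Filter F ->
  (forall i, i \in s -> \forall t \near F, P i t) ->
  \forall t \near F, forall i, i \in s -> P i t.
Proof.
move=> FF; elim: s => [|i s IH] H; first by near=> t.
have Hi := H i (mem_head _ _).
have Hs : \forall t \near F, forall j, j \in s -> P j t.
  by apply: IH => j js; apply: H; rewrite inE js orbT.
near=> t => j; rewrite inE => /orP[/eqP ->|js]; first by near: t.
have : forall j, j \in s -> P j t by near: t.
exact.
Unshelve. all: by end_near. Qed.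

Lemma seq_bound (R : numDomainType) (I : eqType) (s : seq I) (P : I -> R -> Prop) :
  (forall i C D, P i C -> C <= D -> P i D) ->
  (forall i, i \in s -> exists2 C, 0 <= C & P i C) ->
  exists2 C, 0 <= C & forall i, i \in s -> P i C.
Proof.
move=> mono; elim: s => [|i s IH] H; first by exists 0.
have [C C0 HC] := H i (mem_head _ _).
have [|D D0 HD] := IH; first by move=> j js; apply: H; rewrite inE js orbT.
exists (C + D) => [|j]; first exact: addr_ge0.
rewrite inE => /orP[/eqP ->|js]; first by apply: mono HC _; rewrite lerDl.
by apply: mono (HD j js) _; rewrite lerDr.
Qed.

Lemma natr_dist_lt1 (R : numDomainType) (a b : nat) :
  `|a%:R - b%:R| < 1 :> R -> a = b.
Proof.
wlog ab : a b / (a <= b)%N.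
  by move=> H; have [/H //|/ltnW ba] := leqP a b; rewrite distrC => /(H _ _ ba).
rewrite distrC -natrB // normr_nat (ltr_nat _ _ 1) ltnS leqn0 subn_eq0 => ba.
by apply/eqP; rewrite eqn_leq ab.
Qed.

Section EigenvaluePerturbation.
Variables (R : realType) (E : euclideanType R) (n : nat) (p : E -> R) (e : E).
Hypotheses (hp : homogeneous_poly n p) (pe : p e != 0).
Hypothesis rr : forall x, only_real_roots (charpoly p e x).
Variables (x : E) (lam : seq R).
Hypothesis (uniq_lam : uniq lam).
Hypothesis (lamP : forall l : R, (l \in lam) = root (charpoly p e x) l).
Let c := (-1) ^+ n * p e.
Local Notation ev := (eigenvalues p e).

Let c0 : c != 0.
Proof. by rewrite mulf_neq0 // signr_eq0. Qed.

Lemma mem_eigenvalues y l : (l \in ev y) = root (charpoly p e y) l.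
Proof. by rewrite (charpoly_prod hp pe rr) rootZ // root_prod_XsubC. Qed.

Lemma count_eigenvalues y l : count_mem l (ev y) = mup l (charpoly p e y).
Proof. by rewrite (charpoly_prod hp pe rr) mup_prod_XsubC. Qed.

Lemma sum_eigenvalues (G : R -> R) :
  \sum_(z <- ev x) G z = \sum_(l <- lam) (mup l (charpoly p e x))%:R * G l.
Proof.
by rewrite (perm_big _ (eigenvalues_perm hp pe rr uniq_lam lamP)) big_mult_roots.
Qed.

(** [sg] selects once and for all, before [h], a point of [lam] nearly closest to [z]. The square of
    [W] makes every term nonnegative, so that a bound on the sum over the eigenvalues bounds each
    single one. *)
Lemma eigenvalues_near : lam != [::] ->
  exists sg : R -> R, (forall z, sg z \in lam) /\
  exists2 C : R, 0 <= C &
    \forall h \near (0 : E), forall z, z \in ev (x + h) -> `|z - sg z| <= C * `|h|.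
Proof.
move=> lam0; have [D D0 HD] := dist_seq_le_prod uniq_lam lam0.
pose sg z := projT1 (cid2 (HD z)).
have sgP z : sg z \in lam /\ `|z - sg z| <= D * `|\prod_(w <- lam) (z - w)|.
  by rewrite /sg; case: cid2.
exists sg; split; first by move=> z; case: (sgP z).
pose W : {poly R} := \prod_(w <- lam) ('X - w%:P).
have WE z : W.[z] = \prod_(w <- lam) (z - w).
  by rewrite horner_prod; apply: eq_bigr => w _; rewrite !hornerE.
have [g Qg] := smooth_horner_sum hp pe rr x (W ^+ 2).
have S0 : \sum_(z <- ev x) (W ^+ 2).[z] = 0.
  rewrite big_seq big1 // => z; rewrite mem_eigenvalues -lamP => zl.
  have : root W z by rewrite root_prod_XsubC.
  by rewrite horner_exp => /eqP ->; rewrite expr0n.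
have Sge y : 0 <= \sum_(z <- ev y) (W ^+ 2).[z].
  by apply: sumr_ge0 => z _; rewrite horner_exp sqr_ge0.
have g0 := quad_at_min Qg S0 Sge.
case: Qg => C C0; rewrite g0 S0 => HC.
(* [C + 1] stands in for a square root of [C], since [C <= (C + 1) ^+ 2]. *)
exists (D * (C + 1)); first by rewrite mulr_ge0 // addr_ge0.
near=> h => z zh.
have : `|\sum_(z <- ev (x + h)) (W ^+ 2).[z] - 0 - inner 0 h| <= C * `|h| ^+ 2.
  by near: h.
rewrite linear0l !subr0 ger0_norm // => hC.
have {}hC : W.[z] ^+ 2 <= C * `|h| ^+ 2.
  apply: le_trans hC; rewrite (big_rem z) //= horner_exp lerDl.
  by apply: sumr_ge0 => w _; rewrite horner_exp sqr_ge0.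
have [_ /le_trans] := sgP z; apply; rewrite -mulrA ler_wpM2l // -WE.
rewrite -(@ler_pXn2r _ 2) // ?nnegrE ?mulr_ge0 ?addr_ge0 //.
rewrite -normrX ger0_norm ?sqr_ge0 //; apply: le_trans hC _.
rewrite exprMn ler_wpM2r ?sqr_ge0 //; nra.
Unshelve. all: by end_near. Qed.

(** The number of eigenvalues sent to [l] is a sum of values of a fixed polynomial [q] at points of
    [lam]. The sum of [q] over the eigenvalues is continuous at [x], and two natural numbers at
    distance less than [1] are equal. *)
Lemma eigenvalues_multiplicity (sg : R -> R) (C : R) : (forall z, sg z \in lam) ->
  0 <= C ->
  (\forall h \near (0 : E), forall z, z \in ev (x + h) -> `|z - sg z| <= C * `|h|) ->
  \forall h \near (0 : E), perm_eq (map sg (ev (x + h))) (ev x).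
Proof.
move=> sgl C0 HC.
suff : \forall h \near (0 : E), forall l, l \in lam ->
    count_mem l (map sg (ev (x + h))) = count_mem l (ev x).
  move=> H; near=> h; apply/allP => l _ /=; apply/eqP.
  have Hh : forall l, l \in lam -> count_mem l (map sg (ev (x + h))) = count_mem l (ev x).
    by near: h.
  have [/Hh //|nl] := boolP (l \in lam).
  rewrite (count_memPn _) ?(count_memPn _) //.
    by rewrite mem_eigenvalues -lamP.
  by apply/mapP => -[z _ lE]; rewrite lE sgl in nl.
apply: near_all_in => l ll.
(* The Lagrange polynomial equal to [1] at [l] and to [0] at the rest of [lam]. *)
pose q : {poly R} := \prod_(w <- rem l lam) ((l - w)^-1 *: ('X - w%:P)).
have qE w : w \in lam -> q.[w] = (w == l)%:R.
  move=> wl; rewrite horner_prod; case: eqP => [->|/eqP wnl].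
    rewrite big_seq big1 // => u; rewrite mem_rem_uniq // inE => /andP[ul _].
    by rewrite !hornerE mulVf // subr_eq0 eq_sym.
  have wr : w \in rem l lam by rewrite mem_rem_uniq // inE wnl.
  by rewrite (big_rem w) //= !hornerE subrr mulr0 mul0r.
have cntE (s : seq R) : (forall w, w \in s -> w \in lam) ->
    (count_mem l s)%:R = \sum_(w <- s) q.[w].
  elim: s => [|w s IH] sl; first by rewrite big_nil.
  rewrite big_cons /= natrD qE ?sl ?mem_head // IH // => u us.
  by apply: sl; rewrite inE us orbT.
have [D D0 HD] : exists2 D, 0 <= D & forall w, w \in lam ->
    forall a, `|a| <= 1 -> `|q.[w + a] - q.[w]| <= D * `|a|.
  apply: seq_bound => [w A B H AB a a1|w _]; last exact: horner_lipschitz.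
  by apply: le_trans (H a a1) _; rewrite ler_wpM2r.
have [g Qg] := smooth_horner_sum hp pe rr x q.
have [L L0 HL] := quad_at_lip Qg.
have C1 : 0 < C + 1 by lra.
(* [L] accounts for the change of the sum of [q] from [x] to [x + h], and [D * C * n%:R] for
   replacing each of the [n] eigenvalues [z] by [sg z]. *)
have K1 : 0 < L + D * C * n%:R + 1 by rewrite ltr_wpDl // addr_ge0 // !mulr_ge0.
near=> h.
have h1 : `|h| <= (C + 1)^-1 by near: h; apply: nbhs0_le; rewrite invr_gt0.
have h2 : `|h| < (L + D * C * n%:R + 1)^-1 by near: h; apply: nbhs0_lt; rewrite invr_gt0.
have hC : forall z, z \in ev (x + h) -> `|z - sg z| <= C * `|h| by near: h.
have hL : `|\sum_(z <- ev (x + h)) q.[z] - \sum_(z <- ev x) q.[z]| <= L * `|h|.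
  by near: h.
have hS : `|\sum_(z <- ev (x + h)) q.[z] - \sum_(z <- ev (x + h)) q.[sg z]|
    <= D * C * n%:R * `|h|.
  rewrite -sumrB; apply: le_trans (ler_norm_sum _ _ _) _.
  apply: (@le_trans _ _ (\sum_(z <- ev (x + h)) D * (C * `|h|))).
    rewrite big_seq [leRHS]big_seq; apply: ler_sum => z /hC zh.
    have := HD _ (sgl z) (z - sg z); rewrite subrKC => H.
    apply: le_trans (H _) _; last by rewrite ler_wpM2l.
    apply: le_trans zh _; apply: (@le_trans _ _ ((C + 1) * `|h|)).
      by rewrite ler_wpM2r // lerDl.
    by rewrite mulrC -ler_pdivlMr // mul1r.
  rewrite big_const_seq count_predT iter_addr_0 (size_eigenvalues hp pe rr).
  rewrite -[_ *+ n]mulr_natr le_eqVlt; apply/orP; left; apply/eqP; ring.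
have : `|(count_mem l (map sg (ev (x + h))))%:R - (count_mem l (ev x))%:R| < 1 :> R.
  rewrite !cntE; first last.
  - by move=> w /mapP[z _ ->].
  - by move=> w; rewrite lamP mem_eigenvalues.
  rewrite big_map.
  have h3 : (L + D * C * n%:R + 1) * `|h| < 1.
    by rewrite mulrC -ltr_pdivlMr // mul1r.
  have := ler_distD (\sum_(z <- ev (x + h)) q.[z])
    (\sum_(z <- ev (x + h)) q.[sg z]) (\sum_(z <- ev x) q.[z]).
  rewrite [X in _ <= X + _]distrC; have := normr_ge0 h; nra.
exact: natr_dist_lt1.
Unshelve. all: by end_near. Qed.

End EigenvaluePerturbation.

Lemma derive1n_horner (R : realType) (P : {poly R}) m :
  derive1n m (horner P) = horner P^`(m).
Proof. by elim: m => [|m IH] //; rewrite derive1nS IH -derivE -derivnS. Qed.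

(** With [t = a / mu], the inequality [1 - t <= expR (- t)] gives
    [(expR t - 1 - t) * (1 - t) <= t ^+ 2]. The restriction on [a] makes [1 - t] at least
    [1 / 2]. *)
Lemma expR_quadratic (R : realType) (mu l : R) : 0 < mu ->
  exists2 C : R, 0 <= C & forall a, `|a| <= mu / 2 ->
    `|expR ((l + a) / mu) - expR (l / mu) - expR (l / mu) / mu * a| <= C * a ^+ 2.
Proof.
move=> mu0; exists (expR (l / mu) * 2 / mu ^+ 2).
  by rewrite !mulr_ge0 ?expR_ge0 // invr_ge0 sqr_ge0.
move=> a am; pose t := a / mu.
have t2 : `|t| <= 1 / 2.
  rewrite /t normrM normfV (gtr0_norm mu0) ler_pdivrMr //; lra.
rewrite mulrDl expRD -/t.
have -> : expR (l / mu) * expR t - expR (l / mu) - expR (l / mu) / mu * a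
   = expR (l / mu) * (expR t - 1 - t) by rewrite /t; ring.
have -> : expR (l / mu) * 2 / mu ^+ 2 * a ^+ 2 = expR (l / mu) * (2 * t ^+ 2).
  by rewrite /t; field; rewrite gt_eqF.
rewrite normrM (ger0_norm (expR_ge0 _)) ler_wpM2l ?expR_ge0 //.
have h1 := expR_ge1Dx t; have h2 := expR_ge1Dx (- t).
rewrite ger0_norm; last by lra.
move: t2; rewrite ler_norml => /andP[ta tb].
have h3 : expR t * (1 - t) <= 1.
  have : expR t * (1 - t) <= expR t * expR (- t) by rewrite ler_wpM2l ?expR_ge0.
  by rewrite expRxMexpNx_1.
have : 0 <= (expR t - (1 + t)) * (1 / 2 - t) by rewrite mulr_ge0; lra.
nra.
Qed.

(** * Sums of eigenvalue displacements over a cluster *)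

Section ClusterSums.
Variables (R : realType) (E : euclideanType R) (n : nat) (p : E -> R) (e : E).
Hypotheses (hp : homogeneous_poly n p) (pe : p e != 0).
Hypothesis rr : forall x, only_real_roots (charpoly p e x).

Lemma charpoly_shift y l : charpoly p e y \Po ('X + l%:P) = charpoly p e (y - l *: e).
Proof.
apply: horner_inj => t; rewrite horner_comp !hornerE !(charpolyE _ _ _ hp).
by rewrite scalerDl opprD addrA [y - _ - _]addrAC.
Qed.

(** Taylor coefficients at [0]. The sign appears because [dirder] moves along [e] and [charpoly]
    along [- e]. *)
Lemma dirder_charpoly k y : dirder p e k y = (-1) ^+ k * k`!%:R * (charpoly p e y)`_k.
Proof.
rewrite /dirder (_ : (fun t => _) = horner (charpoly p e y \Po (- 'X))); last first.
  apply/funext => t; rewrite horner_comp !hornerE (charpolyE _ _ _ hp).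
  by rewrite scaleNr opprK.
rewrite derive1n_horner horner_coef0 coef_derivn addn0 ffactnn.
have -> : charpoly p e y \Po (- 'X)
    = \poly_(i < size (charpoly p e y)) ((-1) ^+ i * (charpoly p e y)`_i).
  apply: horner_inj => t; rewrite horner_comp hornerN hornerX horner_poly horner_coef.
  by apply: eq_bigr => i _; rewrite [(- t) ^+ i]exprNn mulrCA mulrA.
rewrite coef_poly; case: ltnP => [_|sk]; first by rewrite -[LHS]mulr_natr mulrAC.
by rewrite (nth_default 0 sk) mul0rn mulr0.
Qed.

Variables (x : E) (lam : seq R).
Hypothesis (uniq_lam : uniq lam).
Hypothesis (lamP : forall l : R, (l \in lam) = root (charpoly p e x) l).
Let c := (-1) ^+ n * p e.
Local Notation ev := (eigenvalues p e).
Local Notation m l := (mup l (charpoly p e x)).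

Let c0 : c != 0.
Proof. by rewrite mulf_neq0 // signr_eq0. Qed.

Lemma charpoly_shift_coef l : l \in lam -> (charpoly p e (x - l *: e))`_(m l) != 0.
Proof.
move=> ll; rewrite -(count_eigenvalues hp pe rr) -charpoly_shift.
rewrite (charpoly_prod hp pe rr) comp_polyZ coefZ mulf_neq0 //.
have le : l \in ev x by rewrite (mem_eigenvalues hp pe rr) -lamP.
by have [] := shift_prod_XsubC le.
Qed.

Lemma mult_gt0 l : l \in lam -> (0 < m l)%N.
Proof.
move=> ll; rewrite -(count_eigenvalues hp pe rr) -has_count has_pred1.
by rewrite (mem_eigenvalues hp pe rr) -lamP.
Qed.

(** The expansion of [prod_XsubC_expansion], recentred at [l] and read at rank [(m l).-1]: there the
    linear term only retains the displacements of the eigenvalues attached to [l]. *)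
Lemma cluster_sum (sg : R -> R) (C : R) l : (forall z, sg z \in lam) -> 0 <= C ->
  (\forall h \near (0 : E), forall z, z \in ev (x + h) -> `|z - sg z| <= C * `|h|) ->
  l \in lam ->
  exists2 B : R, 0 <= B & \forall h \near (0 : E),
    `|(charpoly p e (x - l *: e))`_(m l) * \sum_(z <- ev (x + h) | sg z == l) (z - l)
      + ((charpoly p e (x + h - l *: e))`_(m l).-1
         - (charpoly p e (x - l *: e))`_(m l).-1)| <= B * `|h| ^+ 2.
Proof.
move=> sgl C0 HC ll.
have HP := eigenvalues_multiplicity hp pe rr uniq_lam lamP sgl C0 HC.
pose M : R := \sum_(w <- lam) `|w|.
have M0 : 0 <= M by exact: sumr_ge0.
have [A A0 HA] := prod_XsubC_expansion n M0.
have [D D0 HD] := coef_comp_bound l n.+1 (m l).-1.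
exists (`|c| * (D * (A * C ^+ 2))); first by rewrite !mulr_ge0 // sqr_ge0.
have C1 : 0 < C + 1 by lra.
near=> h.
have hC : forall z, z \in ev (x + h) -> `|z - sg z| <= C * `|h| by near: h.
have hp' : perm_eq (map sg (ev (x + h))) (ev x) by near: h.
have h1 : `|h| <= (C + 1)^-1 by near: h; apply: nbhs0_le; rewrite invr_gt0.
have Ch : 0 <= C * `|h| <= 1.
  rewrite mulr_ge0 //=; apply: (@le_trans _ _ ((C + 1) * `|h|)).
    by rewrite ler_wpM2r // lerDl.
  by rewrite mulrC -ler_pdivlMr // mul1r.
pose s := ev (x + h).
(* Equality of multiplicities makes the reference product, over the [sg z], the monic characteristic
   polynomial of [x]. *)
have QE : \prod_(z <- s) ('X - (sg z)%:P) = \prod_(z <- ev x) ('X - z%:P).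
  by rewrite -(big_map sg predT (fun z => 'X - z%:P)); exact: perm_big.
have sM z : z \in s -> `|sg z| <= M /\ `|z - sg z| <= C * `|h|.
  move=> zs; split; last exact: hC.
  by rewrite /M (big_rem _ (sgl z)) /= lerDl sumr_ge0.
have := HA sg s _ (size_eigenvalues hp pe rr _) Ch sM.
set Er := _ - _ + _ => HEr.
(* The bound on recentred coefficients is uniform only for bounded degree. *)
have sEr : (size Er <= n.+1)%N.
  have sQ (t : seq R) : size t = n -> size (\prod_(z <- t) ('X - z%:P)) = n.+1.
    by rewrite size_prod_XsubC => ->.
  have sQ' := sQ _ (size_eigenvalues hp pe rr x).
  have sP' := sQ _ (size_eigenvalues hp pe rr (x + h)).
  apply: leq_trans (size_polyD _ _) _; rewrite geq_max; apply/andP; split.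
    by apply: leq_trans (size_polyD _ _) _; rewrite geq_max size_polyN QE sQ' sP' leqnn.
  apply: leq_trans (size_sum _ _ _) _; apply/bigmax_leqP_seq => z _ _.
  apply: leq_trans (size_scale_leq _ _) _; rewrite QE -sQ'.
  exact: leq_divp.
have := HD Er _ sEr HEr.
(* Dividing by [c] passes from characteristic polynomials to monic products; [shift_prod_XsubC] then
   discards from [lin_term] the eigenvalues of the other clusters. *)
have -> : (Er \Po ('X + l%:P))`_(m l).-1 = c^-1 *
  ((charpoly p e (x - l *: e))`_(m l) * \sum_(z <- ev (x + h) | sg z == l) (z - l)
      + ((charpoly p e (x + h - l *: e))`_(m l).-1
         - (charpoly p e (x - l *: e))`_(m l).-1)).
  rewrite -!(count_eigenvalues hp pe rr) -!charpoly_shift !(charpoly_prod hp pe rr).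
  rewrite -/c -/s !comp_polyZ !coefZ /Er QE comp_polyD comp_polyB coefD coefB.
  rewrite -mulrA -!mulrBr -mulrDr mulKf // addrC; congr (_ + _).
  rewrite /lin_term QE.
  have le : l \in ev x by rewrite (mem_eigenvalues hp pe rr) -lamP.
  have [_ H] := shift_prod_XsubC le.
  rewrite linear_sum coef_sum mulr_sumr [RHS]big_mkcond /=.
  apply: eq_big_seq => z zs; rewrite comp_polyZ coefZ H.
    by case: eqP => [->|_]; rewrite ?mulr0 // mulrC.
  by rewrite (mem_eigenvalues hp pe rr) -lamP.
rewrite normrM normfV ler_pdivrMl ?normr_gt0 // => /le_trans; apply.
by rewrite exprMn !mulrA.
Unshelve. all: by end_near. Qed.

End ClusterSums.

Lemma near_quad_bounds (R : realType) (E : euclideanType R) (s : seq R)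
    (F : R -> E -> R) :
  (forall l, l \in s -> exists2 B : R, 0 <= B &
     \forall h \near (0 : E), `|F l h| <= B * `|h| ^+ 2) ->
  exists2 B : R, 0 <= B & \forall h \near (0 : E),
     forall l, l \in s -> `|F l h| <= B * `|h| ^+ 2.
Proof.
move=> H; have [||B B0 HB] := @seq_bound R _ s
    (fun l B => \forall h \near (0 : E), `|F l h| <= B * `|h| ^+ 2).
- move=> l B B' HB BB'; near=> h; apply: (@le_trans _ _ (B * `|h| ^+ 2)).
    by near: h.
  by rewrite ler_wpM2r // sqr_ge0.
- exact: H.
- by exists B => //; apply: near_all_in.
Unshelve. all: by end_near. Qed.

(** * Gradient of the sum of exponentials, then of its logarithm *)

Section SumOfExponentials.
Variables (R : realType) (E : euclideanType R) (n : nat) (p : E -> R) (e : E).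
Hypotheses (hp : homogeneous_poly n p) (pe : p e != 0).
Hypothesis rr : forall x, only_real_roots (charpoly p e x).
Variables (x : E) (lam : seq R).
Hypothesis (uniq_lam : uniq lam).
Hypothesis (lamP : forall l : R, (l \in lam) = root (charpoly p e x) l).
Local Notation ev := (eigenvalues p e).
Local Notation m l := (mup l (charpoly p e x)).

Lemma smooth_dirder k y : smooth_at (dirder p e k) y.
Proof.
rewrite (_ : dirder p e k = fun y => (-1) ^+ k * k`!%:R * (charpoly p e y)`_k).
  by apply: smooth_atM; [exact: smooth_at_cst|exact: smooth_charpoly hp _].
by apply/funext => z; rewrite (dirder_charpoly _ hp).
Qed.

Lemma quad_at_grad f y : smooth_at f y -> @quad_at R E f y (grad f y).
Proof. by move=> [g Hg]; rewrite (is_gradient_grad (quad_at_gradient Hg)). Qed.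

Lemma dirder_neq0 l : l \in lam -> dirder p e (m l) (x - l *: e) != 0.
Proof.
move=> ll; rewrite (dirder_charpoly _ hp) mulf_neq0 //.
  by rewrite mulf_neq0 ?signr_eq0 // pnatr_eq0 -lt0n fact_gt0.
exact: (charpoly_shift_coef hp pe rr lamP).
Qed.

Lemma cluster_sum_gradient (sg : R -> R) (C : R) l : (forall z, sg z \in lam) -> 0 <= C ->
  (\forall h \near (0 : E), forall z, z \in ev (x + h) -> `|z - sg z| <= C * `|h|) ->
  l \in lam ->
  exists2 B : R, 0 <= B & \forall h \near (0 : E),
    `|\sum_(z <- ev (x + h) | sg z == l) (z - l)
      - (m l)%:R / dirder p e (m l) (x - l *: e)
        * inner (grad (dirder p e (m l).-1) (x - l *: e)) h| <= B * `|h| ^+ 2.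
Proof.
move=> sgl C0 HC ll.
have [B B0 HB] := cluster_sum hp pe rr uniq_lam lamP sgl C0 HC ll.
have [B' B'0 HB'] := quad_at_grad (smooth_dirder (m l).-1 (x - l *: e)).
have D0 := dirder_neq0 ll; have m0 := mult_gt0 hp pe rr lamP ll.
set g := grad _ _ in HB' *.
(* The factor from the coefficient of rank [(m l).-1] of [charpoly] to the derivative of that
   order. *)
pose k : R := (-1) ^+ (m l).-1 * ((m l).-1)`!%:R.
pose r : R := (m l)%:R / dirder p e (m l) (x - l *: e).
exists (`|r| * (`|k| * B + B')); first by rewrite mulr_ge0 // addr_ge0 // mulr_ge0.
(* From order [(m l).-1] to order [m l], the factor gains [m l] and one sign. This sign turns the
   sum bounded in [cluster_sum] into the difference bounded here. *)
have DE : dirder p e (m l) (x - l *: e)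
    = - ((m l)%:R * k * (charpoly p e (x - l *: e))`_(m l)).
  rewrite (dirder_charpoly _ hp) /k -[in LHS](prednK m0) factS natrM exprS.
  have gen (s M f a : R) : -1 * s * (M * f) * a = - (M * (s * f) * a) by ring.
  by rewrite prednK // gen.
near=> h.
have h1 : `|(charpoly p e (x - l *: e))`_(m l) * \sum_(z <- ev (x + h) | sg z == l) (z - l)
      + ((charpoly p e (x + h - l *: e))`_(m l).-1
         - (charpoly p e (x - l *: e))`_(m l).-1)| <= B * `|h| ^+ 2 by near: h.
have h2 : `|dirder p e (m l).-1 (x - l *: e + h) - dirder p e (m l).-1 (x - l *: e)
   - inner g h| <= B' * `|h| ^+ 2 by near: h.
rewrite !(dirder_charpoly _ hp) -/k [x - _ + h]addrAC in h2.
set S := \sum_(z <- _ | _) _ in h1 *.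
(* The Taylor remainder of [dirder p e (m l).-1], minus [k] times the quantity bounded by
   [cluster_sum]. *)
have -> : S - r * inner g h = r *
  ((k * (charpoly p e (x + h - l *: e))`_(m l).-1
     - k * (charpoly p e (x - l *: e))`_(m l).-1 - inner g h)
   - k * ((charpoly p e (x - l *: e))`_(m l) * S + ((charpoly p e (x + h - l *: e))`_(m l).-1
         - (charpoly p e (x - l *: e))`_(m l).-1))).
  have gen (M k' a S' p1 p0 i : R) : M * k' * a != 0 ->
      S' - M / - (M * k' * a) * i
      = M / - (M * k' * a) * (k' * p1 - k' * p0 - i - k' * (a * S' + (p1 - p0))).
    rewrite !mulf_eq0 !negb_or => /andP[/andP[M0 k0] a0]; field.
    by rewrite a0 k0 M0.
  by rewrite /r DE; apply: gen; rewrite -oppr_eq0 -DE.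
rewrite normrM -[leRHS]mulrA ler_wpM2l // [leRHS]mulrDl [leRHS]addrC.
apply: le_trans (ler_normB _ _) _; apply: lerD => //.
by rewrite normrM -[leRHS]mulrA ler_wpM2l.
Unshelve. all: by end_near. Qed.

Lemma quad_at_sum_exp (mu : R) : 0 < mu -> lam != [::] ->
  quad_at (fun y => \sum_(z <- ev y) expR (z / mu)) x
    (\sum_(l <- lam) (expR (l / mu) / mu * ((m l)%:R / dirder p e (m l) (x - l *: e)))
       *: grad (dirder p e (m l).-1) (x - l *: e)).
Proof.
move=> mu0 lam0.
have [sg [sgl [C C0 HC]]] := eigenvalues_near hp pe rr uniq_lam lamP lam0.
have HP := eigenvalues_multiplicity hp pe rr uniq_lam lamP sgl C0 HC.
have [B B0 HB] := near_quad_bounds (fun l => @cluster_sum_gradient sg C l sgl C0 HC).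
have [A A0 HA] : exists2 A : R, 0 <= A & forall l, l \in lam -> forall a, `|a| <= mu / 2 ->
    `|expR ((l + a) / mu) - expR (l / mu) - expR (l / mu) / mu * a| <= A * a ^+ 2.
  apply: seq_bound => [l A A' H AA' a am|l _]; last exact: expR_quadratic.
  by apply: le_trans (H a am) _; rewrite ler_wpM2r // sqr_ge0.
pose G' l : R := expR (l / mu) / mu.
exists (n%:R * (A * C ^+ 2) + (\sum_(l <- lam) G' l) * B).
  rewrite addr_ge0 // ?mulr_ge0 ?sqr_ge0 // sumr_ge0 // => l _.
  by rewrite divr_ge0 ?expR_ge0 // ltW.
have C1 : 0 < C + 1 by lra.
near=> h.
have hC : forall z, z \in ev (x + h) -> `|z - sg z| <= C * `|h| by near: h.
have hp' : perm_eq (map sg (ev (x + h))) (ev x) by near: h.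
have hB : forall l, l \in lam -> `|\sum_(z <- ev (x + h) | sg z == l) (z - l)
      - (m l)%:R / dirder p e (m l) (x - l *: e)
        * inner (grad (dirder p e (m l).-1) (x - l *: e)) h| <= B * `|h| ^+ 2.
  by near: h.
have h1 : `|h| <= mu / 2 / (C + 1).
  by near: h; apply: nbhs0_le; rewrite !divr_gt0.
have Ch : C * `|h| <= mu / 2.
  apply: (@le_trans _ _ ((C + 1) * `|h|)).
    by rewrite ler_wpM2r // lerDl.
  by rewrite mulrC -ler_pdivlMr.
(* Replaces the eigenvalues of [x] by the [sg z], so that both sums run over the eigenvalues of
   [x + h]. *)
rewrite -[X in _ - X - _](perm_big _ hp') big_map.
have grp : \sum_(z <- ev (x + h)) G' (sg z) * (z - sg z)
    = \sum_(l <- lam) G' l * \sum_(z <- ev (x + h) | sg z == l) (z - l).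
  under [RHS]eq_bigr do rewrite mulr_sumr big_mkcond /=.
  rewrite exchange_big /=; apply: eq_bigr => z _.
  rewrite (bigD1_seq (sg z)) //= eqxx big1 ?addr0 // => l /negPf nl.
  by rewrite eq_sym nl.
rewrite linear_sumlz.
(* The first sum consists of [n] quadratic remainders of the exponential. In the second, the linear
   parts are grouped by cluster with a common weight [G' l]. *)
rewrite (_ : _ - _ - _ =
  \sum_(z <- ev (x + h)) (expR (z / mu) - expR (sg z / mu) - G' (sg z) * (z - sg z))
  + \sum_(l <- lam) G' l * (\sum_(z <- ev (x + h) | sg z == l) (z - l)
      - (m l)%:R / dirder p e (m l) (x - l *: e)
        * inner (grad (dirder p e (m l).-1) (x - l *: e)) h)); last first.
  under [X in _ = _ + X]eq_bigr do rewrite mulrBr.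
  rewrite !sumrB grp.
  under [X in _ - X = _]eq_bigr do rewrite linearZl_LR /= -mulrA.
  rewrite [RHS]addrA subrK; congr (_ - _); apply: eq_bigr => l _.
  by rewrite /G' !mulrA.
rewrite mulrDl; apply: le_trans (ler_normD _ _) _; apply: lerD.
  apply: le_trans (ler_norm_sum _ _ _) _.
  apply: (@le_trans _ _ (\sum_(z <- ev (x + h)) A * C ^+ 2 * `|h| ^+ 2)).
    rewrite big_seq [leRHS]big_seq; apply: ler_sum => z /hC zh.
    have := HA _ (sgl z) (z - sg z); rewrite subrKC => H.
    apply: le_trans (H (le_trans zh Ch)) _.
    rewrite -mulrA ler_wpM2l // -exprMn -real_normK ?num_real //.
    by rewrite lerXn2r ?nnegrE ?mulr_ge0.
  rewrite big_const_seq count_predT iter_addr_0 (size_eigenvalues hp pe rr).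
  by rewrite -[leLHS]mulr_natl mulrA.
apply: le_trans (ler_norm_sum _ _ _) _; rewrite -mulrA mulr_suml.
rewrite big_seq [leRHS]big_seq; apply: ler_sum => l ll.
have G0 : 0 <= G' l by rewrite divr_ge0 ?expR_ge0 // ltW.
by rewrite normrM (ger0_norm G0) ler_wpM2l // hB.
Unshelve. all: by end_near. Qed.

End SumOfExponentials.

(** A form of degree [0] is constant. Being nonzero at [x0], it vanishes nowhere, and the lines
    through [x0] show that the component of [x0] is the whole space, against [K <> setT]. *)
Lemma homogeneous_degree_gt0 (R : realType) (E : euclideanType R) n (p : E -> R) (K : set E) :
  is_cone K -> K <> setT -> hyperbolic_poly n p K -> (0 < n)%N.
Proof.
move=> coneK properK [hp [x0 px0 KE] _]; rewrite lt0n; apply/negP => /eqP n0.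
apply: properK; apply/seteqP; split => // y _.
have p0 z : p z = p 0 by have := homog_scale 0 z hp; rewrite scale0r n0 expr0 mul1r.
apply: interior_subset; rewrite KE.
pose line (t : R) : E := x0 + t *: (y - x0).
have cl : connected (line @` setT).
  apply: connected_continuous_connected; first exact/connected_intervalP.
  apply: continuous_subspaceT => t.
  apply: cvgD; first exact: cvg_cst.
  by apply: cvgZr_tmp; exact: cvg_id.
exists (line @` setT); last by exists 1 => //; rewrite /line scale1r addrC subrK.
split=> //; first by exists 0 => //; rewrite /line scale0r addr0.
by move=> _ [t _ <-] /=; rewrite p0 -(p0 x0).
Qed.

Lemma is_gradient_ln (R : realType) (E : euclideanType R) (f : E -> R) (x g : E)
    (mu : R) : is_gradient f x g -> 0 < f x ->
  is_gradient (fun y => mu * ln (f y)) x ((mu / f x) *: g).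
Proof.
move=> [df dfE] fx0.
pose L : R -> R := fun t => mu * ln t.
have dln : is_derive (f x) 1 (@ln R) (f x)^-1 by exact: is_derive1_ln.
have dL : is_derive (f x) 1 L (mu * (f x)^-1) by exact: is_deriveZ.
have DL : derivable L (f x) 1 by [].
have dfL : differentiable L (f x) by exact/derivable1_diffP.
split; first exact: (@differentiable_comp _ _ _ _ f L x df dfL).
move=> v; rewrite -[fun y => _]/(L \o f) (diff_comp df dfL) /=.
rewrite deriv1E // derive1E derive_val dfE linearZl_LR /=.
exact: mulrC.
Qed.

Theorem proposition3p3 (R : realType) (E : euclideanType R)
    (K : set E) (n : nat) (p : E -> R) (e : E)
    (closedK : closed K) (convexK : convex_set K) (coneK : is_cone K)
    (intK : K° !=set0) (properK : K <> setT)
    (hypp : hyperbolic_poly n p K) (inte : K° e)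
    (x : E) (lam : seq R) (uniq_lam : uniq lam)
    (lamP : forall l : R, (l \in lam) = root (charpoly p e x) l) :
  let m := fun l : R => mup l (charpoly p e x) in
  let v := fun l : R =>
    (dirder p e (m l) (x - l *: e))^-1
      *: grad (dirder p e (m l).-1) (x - l *: e) in
  (forall l : R, l \in lam -> dirder p e (m l) (x - l *: e) != 0) /\
  forall mu : R, 0 < mu ->
    let Z := \sum_(l <- lam) (m l)%:R * expR (l / mu) in
    [/\ differentiable (fmu p e mu) x,
        grad (fmu p e mu) x
          = Z^-1 *: \sum_(l <- lam)
              ((m l)%:R * expR (l / mu) / dirder p e (m l) (x - l *: e))
                *: grad (dirder p e (m l).-1) (x - l *: e)
      & convex_combination lam (fun l => Z^-1 * ((m l)%:R * expR (l / mu))) v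
          (grad (fmu p e mu) x)].
Proof.
move=> m v.
(* A positive degree provides an eigenvalue, whence [0 < Z]. *)
have n0 := homogeneous_degree_gt0 coneK properK hypp.
have [hp [x0 _ KE] [e' inte' rr']] := hypp.
have p0 y : K° y -> p y != 0.
  by rewrite KE => /connected_component_sub.
have pe := p0 e inte.
(* The direction [e'] given by hyperbolicity is exchanged for [e]: the points [e + r *: e'] stay in
   the interior of the cone, where [p] does not vanish. *)
have rr : forall y, only_real_roots (charpoly p e y).
  apply: (garding hp rr' (p0 e' inte')) => r r0.
  by apply: p0; exact: interior_cone_add.
split=> [l ll|mu mu0 Z]; first exact: (dirder_neq0 hp pe rr lamP).
have lam0 : lam != [::].
  have : (0 < size (eigenvalues p e x))%N by rewrite (size_eigenvalues hp pe rr).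
  case evE : (eigenvalues p e x) => [//|z s] _.
  have : z \in lam by rewrite lamP -(mem_eigenvalues hp pe rr) evE mem_head.
  by case: (lam).
have FZ : \sum_(z <- eigenvalues p e x) expR (z / mu) = Z.
  exact: (sum_eigenvalues hp pe rr uniq_lam lamP (fun z => expR (z / mu))).
have Z0 : 0 < Z.
  have [l ll] : exists l, l \in lam.
    by case: (lam) lam0 => // l s _; exists l; rewrite mem_head.
  rewrite /Z (big_rem l) //= ltr_pwDl ?mulr_gt0 ?expR_gt0 ?ltr0n //.
    exact: (mult_gt0 hp pe rr lamP).
  by apply: sumr_ge0 => w _; rewrite mulr_ge0 ?expR_ge0.
have := is_gradient_ln mu (quad_at_gradient
  (quad_at_sum_exp hp pe rr uniq_lam lamP mu0 lam0)).
rewrite /= FZ => /(_ Z0).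
set G := (_ *: _) => HG.
(* The factor [mu] in front of the logarithm cancels the [1 / mu] from differentiating
   [expR (l / mu)]. *)
have GE : G = Z^-1 *: \sum_(l <- lam)
              ((m l)%:R * expR (l / mu) / dirder p e (m l) (x - l *: e))
                *: grad (dirder p e (m l).-1) (x - l *: e).
  rewrite /G mulrC -scalerA scaler_sumr; congr (_ *: _).
  apply: eq_bigr => l _; rewrite scalerA; congr (_ *: _).
  by rewrite mulrA [mu * _]mulrC divfK ?gt_eqF // mulrCA mulrA.
have gE : grad (fmu p e mu) x = G by exact: is_gradient_grad.
split; [by case: HG|by rewrite gE|split].
- by move=> l _; rewrite !mulr_ge0 ?invr_ge0 ?expR_ge0 // ltW.
- by rewrite -mulr_sumr mulVf // gt_eqF.
- rewrite gE GE scaler_sumr; apply: eq_bigr => l _.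
  by rewrite /v !scalerA !mulrA.
Qed.
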